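(* Let $R=R(A,\alpha,v,\rho)$ be a conformal ambiskew polynomial ring over an $\mathbb F$-algebra $A$, where $\mathbb F$ is a field (with associated automorphism $\gamma$), let $u$ be a (fixed) splitting element, let $z=xy-u$ be the Casimir element, and let $S=R_{\mathcal Z}$ be the localization of $R$ at $\mathcal Z=\{z^i\}_{i\geq 0}$. Suppose that $u$ is not nilpotent. Then $S$ is simple if and only if (i) $A$ is $\{\alpha,\gamma\}$-simple; (ii) there does not exist $j\in\mathbb Z\setminus\{0\}$ such that $A$ has a $(0,j)$-special element; (iii) for all $m\geq 1$, there exists $n\geq 0$ such that $u^n\in v^{(m)}A$, where $v^{(m)}:=\sum_{l=0}^{m-1}\rho^{l}\alpha^{l}(v)$.
   Context: Rings are associative with $1$. For an automorphism $\theta$ of a ring $A$, an element $c\in A$ is $\theta$-normal if $ca=\theta(a)c$ for all $a\in A$ and $\theta(c)=c$. An ideal $I$ of $A$ is an $\{\alpha,\gamma\}$-ideal if $\alpha(I)\subseteq I$ and $\gamma(I)\subseteq I$; $A$ is $\{\alpha,\gamma\}$-simple if $0$ and $A$ are its only $\{\alpha,\gamma\}$-ideals. Ambiskew polynomial ring: Let $\mathbb F$ be a field, $A$ an $\mathbb F$-algebra, $\rho\in\mathbb F\setminus\{0\}$, $\gamma$ an $\mathbb F$-automorphism of $A$, $v$ a $\gamma$-normal element of $A$, $\alpha$ an $\mathbb F$-automorphism of $A$ with $\alpha\gamma=\gamma\alpha$, and $\beta:=\alpha^{-1}\gamma$. Extend $\beta$ to an automorphism of $A[y;\alpha]$ with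 $\beta(y)=\rho y$; there is a $\beta$-derivation $\delta$ of $A[y;\alpha]$ with $\delta(A)=0$, $\delta(y)=v$. The ambiskew polynomial ring is $R(A,\alpha,v,\rho)=A[y;\alpha][x;\beta,\delta]$; thus $ya=\alpha(a)y$, $xa=\beta(a)x$ ($a\in A$) and $xy=\rho yx+v$. The automorphism $\gamma$ is part of the data. $R$ is conformal if there is a splitting element, i.e. a $\gamma$-normal $u\in A$ with $v=u-\rho\alpha(u)$. Then the Casimir element $z=xy-u=\rho(yx-\alpha(u))$ is normal in $R$: $zy=\rho yz$, $zx=\rho^{-1}xz$, $za=\gamma(a)z$ for $a\in A$. For $m,j\in\mathbb Z$, a non-zero element $c\in A$ is $(m,j)$-special if $\gamma(c)=\rho^m c$, $\alpha(c)=\rho^j c$ and $c$ is $\alpha^m\gamma^{-j}$-normal. *)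

(* Defs.v *)
From HB Require Import structures.
From mathcomp Require Import all_boot all_order all_algebra.

Set Implicit Arguments.
Unset Strict Implicit.
Unset Printing Implicit Defensive.

Import GRing.Theory.
Local Open Scope ring_scope.

Record algAut (F : fieldType) (A : algType F) := AlgAut {
  aut_fun :> {lrmorphism A -> A};
  aut_inv : A -> A;
  autK : cancel aut_fun aut_inv;
  autVK : cancel aut_inv aut_fun }.

Definition aut_exp (F : fieldType) (A : algType F) (f : algAut A) (m : int)
    (a : A) : A :=
  match m with
  | Posz n => iter n f a
  | Negz n => iter n.+1 (aut_inv f) a
  end.

Definition is_normal (A : nzRingType) (theta : A -> A) (c : A) : Prop :=
  (forall a, c * a = theta a * c) /\ theta c = c.

Definition is_ideal (A : nzRingType) (I : A -> Prop) : Prop :=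
  [/\ I 0,
      forall a b, I a -> I b -> I (a - b),
      forall r a, I a -> I (r * a)
    & forall r a, I a -> I (a * r)].

(* Rings of type nzRingType are nonzero, so the usual requirement that a
   simple ring be nonzero is automatic here. *)
Definition simple_ring (A : nzRingType) : Prop :=
  forall I : A -> Prop, is_ideal I ->
    (forall a, I a <-> a = 0) \/ (forall a, I a).

Definition simple_under2 (A : nzRingType) (alpha gamma : A -> A) : Prop :=
  forall I : A -> Prop, is_ideal I ->
    (forall a, I a -> I (alpha a)) -> (forall a, I a -> I (gamma a)) ->
    (forall a, I a <-> a = 0) \/ (forall a, I a).

Definition skew_derivation (A : nzRingType) (sigma delta : A -> A) : Prop :=
  (forall a b, delta (a + b) = delta a + delta b) /\
  (forall a b, delta (a * b) = sigma a * delta b + delta a * b).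

(* T = A[y; sigma, delta]: T is an overring of A (via iota) which is free as a
   left A-module on the powers of y, with y a = sigma(a) y + delta(a).
   The polynomial p only serves as a finitely supported family of
   coefficients; injectivity of iota follows from uniqueness of p. *)
Definition ore_extension (A : nzRingType) (sigma delta : A -> A)
    (T : nzRingType) (iota : {rmorphism A -> T}) (y : T) : Prop :=
  (forall a, y * iota a = iota (sigma a) * y + iota (delta a)) /\
  (forall t, exists! p : {poly A},
     t = \sum_(i < size p) iota p`_i * y ^+ i).

(* R = R(A, alpha, v, rho) = A[y; alpha][x; beta, delta] with T = A[y; alpha];
   scalars of F are viewed in A as rho%:A. *)
Record ambiskew_ring (F : fieldType) (A : algType F) (alpha gamma : algAut A)
    (v : A) (rho : F)
    (T : nzRingType) (iA : {rmorphism A -> T}) (y : T)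
    (beta : {rmorphism T -> T}) (delta : T -> T)
    (R : nzRingType) (iT : {rmorphism T -> R}) (x : R) : Prop := AmbiskewRing {
  ambiskew_inner : ore_extension alpha (fun=> 0) iA y;
  ambiskew_beta_bij : bijective beta;
  ambiskew_betaA : forall a, beta (iA a) = iA (aut_inv alpha (gamma a));
  ambiskew_beta_y : beta y = iA rho%:A * y;
  ambiskew_delta : skew_derivation beta delta;
  ambiskew_deltaA : forall a, delta (iA a) = 0;
  ambiskew_delta_y : delta y = iA v;
  ambiskew_outer : ore_extension beta delta iT x }.

Definition splitting_element (F : fieldType) (A : algType F)
    (alpha gamma : algAut A) (v : A) (rho : F) (u : A) : Prop :=
  is_normal gamma u /\ v = u - rho *: alpha u.

(* S is the (right) ring of fractions of R at Z.  For Z the set of powers of a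
   normal element, left and right fractions agree. *)
Definition localization (R : nzRingType) (Z : R -> Prop)
    (S : nzRingType) (phi : {rmorphism R -> S}) : Prop :=
  [/\ forall s, Z s -> exists w, phi s * w = 1 /\ w * phi s = 1,
      forall q, exists r s, Z s /\ q * phi s = phi r
    & forall r, phi r = 0 <-> exists s, Z s /\ r * s = 0].

Definition powers (R : nzRingType) (z : R) (r : R) : Prop :=
  exists i : nat, r = z ^+ i.

Definition special (F : fieldType) (A : algType F) (alpha gamma : algAut A)
    (rho : F) (m j : int) (c : A) : Prop :=
  [/\ c <> 0,
      gamma c = rho ^ m *: c,
      alpha c = rho ^ j *: c
    & is_normal (fun a => aut_exp alpha m (aut_exp gamma (- j) a)) c].

Definition v_sum (F : fieldType) (A : algType F) (alpha : algAut A)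
    (v : A) (rho : F) (m : nat) : A :=
  \sum_(0 <= l < m) rho ^+ l *: iter l alpha v.

(* Main.v *)
Require Import Defs.
From HB Require Import structures.
From mathcomp Require Import all_boot all_order all_algebra.
From Stdlib Require Import Classical.

Set Implicit Arguments.
Unset Strict Implicit.
Unset Printing Implicit Defensive.

Import GRing.Theory.
Local Open Scope ring_scope.

(** Since [z] is normal and regular in [R], the localization [S] is simple if
    and only if every nonzero ideal [K] of [R] contains a power of [z].

    Necessity.  (i) If [I] is a proper nonzero {alpha, gamma}-ideal, so is the
    union [I'] of its preimages under the powers of [alpha gamma], which is also
    stable under [alpha^-1]; then [I' R] is an ideal, and it contains no [z^n]
    because [z^n] has leading term a unit times [y^n x^n].  (ii) A
    (0,j)-special [c] is a unit by (i), so up to replacing [c] by [c^-1] we have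
    [j = -n < 0]; then [z^n + c] is normal, and modulo it [z] is invertible,
    so the ideal it generates would be [R], which is impossible by degree in
    [x].  (iii) The left module obtained from [R / R x] by
    killing [y^m] and, in degree [i], the ideal [alpha^-(m-1-i)(v^(m) A)], is
    annihilated by [y^m]; as [z] acts in degree 0 as [- rho alpha(u)], the
    presence of [z^n] in [R y^m R] forces [u^n] into [v^(m) A].

    Sufficiency.  Multiplying by a power of [y] puts a nonzero element of [K]
    in the span of the monomials [a y^i z^k]; choose such an element [f] with a
    minimal number of terms.  By (i) one may assume that its coefficient is 1 at
    a term [(i0, k0)] with [i0] minimal.  The commutators of [f] with [A], [z]
    and [y] have fewer terms, hence vanish, and the coefficient of [f] at
    [(i, k)] is (i0 - i, k - k0)-special, hence 0 or a unit.  A commutator with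
    [x] shows that it is annihilated by [v^(i - i0)], hence is 0 by (iii) if
    [i > i0]; it is 0 by (ii) if [i = i0] and [k <> k0].  So [y^i0 z^k0] lies in
    [K], and (iii) lowers the exponent of [y] to 0. *)

(** * Ideals *)

Section AdditiveSpan.

Variables (R : nzRingType) (G : R -> Prop).

Inductive add_span : R -> Prop :=
| add_span0 : add_span 0
| add_spanD x y : G x -> add_span y -> add_span (x + y).

Lemma add_span_gen x : G x -> add_span x.
Proof. by move=> Gx; rewrite -[x]addr0; apply: add_spanD Gx add_span0. Qed.

Lemma add_span_add x y : add_span x -> add_span y -> add_span (x + y).
Proof.
move=> sx sy; elim: sx => [|x' y' Gx _ IH]; first by rewrite add0r.
by rewrite -addrA; apply: add_spanD.
Qed.

(** Sums alone suffice in [add_span]: once it is stable under left multiplication, multiplying by -1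
    supplies the negatives. *)
Lemma add_span_ideal :
    (forall r x, G x -> add_span (r * x)) ->
    (forall r x, G x -> add_span (x * r)) ->
  is_ideal add_span.
Proof.
move=> Gl Gr.
have sl r x : add_span x -> add_span (r * x).
  elim=> [|x' y' Gx _ IH]; first by rewrite mulr0; apply: add_span0.
  by rewrite mulrDr; apply: add_span_add => //; apply: Gl.
split=> //; first exact: add_span0.
- by move=> a b sa sb; apply: add_span_add => //; rewrite -mulN1r; apply: sl.
- move=> r a; elim=> [|x' y' Gx _ IH]; first by rewrite mul0r; apply: add_span0.
  by rewrite mulrDl; apply: add_span_add => //; apply: Gr.
Qed.

Lemma add_span_sub (P : R -> Prop) :
    P 0 -> (forall x y, P x -> P y -> P (x + y)) -> (forall x, G x -> P x) ->
  forall x, add_span x -> P x.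
Proof. by move=> P0 PD PG x; elim=> // a b Ga _; apply: PD; apply: PG. Qed.

End AdditiveSpan.

Section Ideals.

Variables (R : nzRingType) (I : R -> Prop).
Hypothesis I_ideal : is_ideal I.

Lemma is_ideal0 : I 0. Proof. by case: I_ideal. Qed.

Lemma is_idealB a b : I a -> I b -> I (a - b).
Proof. by case: I_ideal => _ IB _ _; apply: IB. Qed.

Lemma is_idealN a : I a -> I (- a).
Proof. by move=> Ia; rewrite -sub0r; apply: is_idealB Ia; apply: is_ideal0. Qed.

Lemma is_idealD a b : I a -> I b -> I (a + b).
Proof. by move=> Ia Ib; rewrite -[b]opprK;
  apply: is_idealB Ia (is_idealN Ib). Qed.

Lemma is_idealMl r a : I a -> I (r * a).
Proof. by case: I_ideal => _ _ IM _; apply: IM. Qed.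

Lemma is_idealMr r a : I a -> I (a * r).
Proof. by case: I_ideal => _ _ _ IM; apply: IM. Qed.

End Ideals.

(** * Ore extensions *)

Section OrePolynomials.

Variables (A T : nzRingType) (sigma : {rmorphism A -> A}) (delta : A -> A).
Variables (iota : {rmorphism A -> T}) (y : T).
Hypothesis T_ore : ore_extension sigma delta iota y.

(** Only left multiplication by constants and right multiplication by ['X] carry over to [T];
    because of the twist, products of polynomials in general do not. *)
Definition ore_eval (p : {poly A}) : T := (map_poly iota p).[y].

Lemma ore_comm a : y * iota a = iota (sigma a) * y + iota (delta a).
Proof. by case: T_ore. Qed.

Lemma ore_evalE p : ore_eval p = \sum_(i < size p) iota p`_i * y ^+ i.
Proof.
rewrite /ore_eval (@horner_coef_wide _ (size p)) ?size_poly //.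
by apply: eq_bigr => i _; rewrite coef_map.
Qed.

Lemma ore_eval_surj t : exists p, t = ore_eval p.
Proof.
case: T_ore => _ /(_ t) [p [-> _]]; exists p; by rewrite ore_evalE.
Qed.

Lemma ore_eval_inj : injective ore_eval.
Proof.
move=> p q Epq; case: T_ore => _ /(_ (ore_eval p)) [r [_ r_uniq]].
by rewrite -(r_uniq p (ore_evalE p)) -(r_uniq q) // Epq ore_evalE.
Qed.

Lemma ore_eval0 : ore_eval 0 = 0.
Proof. by rewrite /ore_eval rmorph0 horner0. Qed.

Lemma ore_evalD p q : ore_eval (p + q) = ore_eval p + ore_eval q.
Proof. by rewrite /ore_eval rmorphD hornerD. Qed.

Lemma ore_eval_lmul a p : ore_eval (a%:P * p) = iota a * ore_eval p.
Proof. by rewrite /ore_eval rmorphM /= map_polyC hornerCM. Qed.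

Lemma ore_evalC a : ore_eval a%:P = iota a.
Proof. by rewrite /ore_eval map_polyC hornerC. Qed.

Lemma ore_iota_inj : injective iota.
Proof. by move=> a b; rewrite -!ore_evalC => /ore_eval_inj/polyC_inj. Qed.

Lemma ore_evalMX p : ore_eval (p * 'X) = ore_eval p * y.
Proof. by rewrite /ore_eval rmorphM /= map_polyX hornerMX. Qed.

Lemma ore_evalMXn p n : ore_eval (p * 'X^n) = ore_eval p * y ^+ n.
Proof.
elim: n => [|n IH]; first by rewrite !expr0 !mulr1.
by rewrite !exprSr !mulrA ore_evalMX IH.
Qed.

Definition ore_deg_lt (n : nat) (r : T) : Prop :=
  exists2 p : {poly A}, (size p <= n)%N & r = ore_eval p.

Lemma ore_deg_ltW m n r : (m <= n)%N -> ore_deg_lt m r -> ore_deg_lt n r.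
Proof. by move=> le_mn [p sz_p ->]; exists p => //; apply: leq_trans le_mn. Qed.

Lemma ore_deg_lt0 n : ore_deg_lt n 0.
Proof. by exists 0; rewrite ?size_poly0 ?ore_eval0. Qed.

Lemma ore_deg_ltD n r s
  : ore_deg_lt n r -> ore_deg_lt n s -> ore_deg_lt n (r + s).
Proof.
move=> [p sz_p ->] [q sz_q ->]; exists (p + q); last by rewrite ore_evalD.
by rewrite (leq_trans (size_polyD _ _)) // geq_max sz_p.
Qed.

Lemma ore_deg_lt_lmul n a r : ore_deg_lt n r -> ore_deg_lt n (iota a * r).
Proof.
move=> [p sz_p ->]; exists (a%:P * p); last by rewrite ore_eval_lmul.
rewrite (leq_trans (size_polyMleq _ _)) // size_polyC.
by case: (a == 0) => /=; rewrite ?add0n ?add1n //= (leq_trans (leq_pred _)).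
Qed.

Lemma ore_deg_lt_mulX n r : ore_deg_lt n r -> ore_deg_lt n.+1 (r * y).
Proof.
move=> [p sz_p ->]; exists (p * 'X); last by rewrite ore_evalMX.
by rewrite (leq_trans (size_polyMleq _ _)) // size_polyX addn2.
Qed.

Lemma ore_deg_lt_mon n a m : (m < n)%N -> ore_deg_lt n (iota a * y ^+ m).
Proof.
move=> lt_mn; exists (a%:P * 'X^m); last by rewrite ore_evalMXn ore_evalC.
rewrite (leq_trans (size_polyMleq _ _)) // size_polyC size_polyXn addnS /=.
by case: (a == 0); rewrite /= ?add0n ?add1n // ltnW.
Qed.

Lemma ore_deg_lt_sum m n (F : 'I_m -> T) :
  (forall i, ore_deg_lt n (F i)) -> ore_deg_lt n (\sum_i F i).
Proof.
move=> HF; apply: (big_ind (ore_deg_lt n)) => //; first exact: ore_deg_lt0.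
exact: ore_deg_ltD.
Qed.

Lemma ore_deg_lt_mulX_l n r : ore_deg_lt n r -> ore_deg_lt n.+1 (y * r).
Proof.
move=> [p sz_p ->]; rewrite ore_evalE mulr_sumr.
apply: ore_deg_lt_sum => i; have lt_in := leq_trans (ltn_ord i) sz_p.
rewrite mulrA ore_comm mulrDl -mulrA -exprS.
apply: ore_deg_ltD; apply: ore_deg_lt_mon; rewrite ?ltnS //.
exact: ltnW.
Qed.

Lemma ore_deg_lt_mulXn_l k n r
  : ore_deg_lt n r -> ore_deg_lt (k + n) (y ^+ k * r).
Proof.
move=> Hr; elim: k => [|k IH]; first by rewrite mul1r.
by rewrite exprS -mulrA addSn; apply: ore_deg_lt_mulX_l.
Qed.

Lemma ore_deg_lt_mulXn k n r
  : ore_deg_lt n r -> ore_deg_lt (n + k) (r * y ^+ k).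
Proof.
move=> Hr; elim: k => [|k IH]; first by rewrite mulr1 addn0.
by rewrite exprSr mulrA addnS; apply: ore_deg_lt_mulX.
Qed.

Lemma ore_deg_ltM m n r s :
  ore_deg_lt m r -> ore_deg_lt n.+1 s -> ore_deg_lt (m + n) (r * s).
Proof.
move=> [p sz_p ->] Hs; rewrite ore_evalE mulr_suml.
apply: ore_deg_lt_sum => i; rewrite -mulrA; apply: ore_deg_lt_lmul.
apply: ore_deg_ltW (ore_deg_lt_mulXn_l i Hs).
by rewrite addnS ltn_add2r (leq_trans (ltn_ord i)).
Qed.

(** [a] may be zero, so top terms of products can be computed before asking whether they cancel. *)
Definition ore_top (n : nat) (a : A) (r : T) : Prop :=
  exists2 r', ore_deg_lt n r' & r = iota a * y ^+ n + r'.

Lemma ore_top_deg n a r : ore_top n a r -> ore_deg_lt n.+1 r.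
Proof.
move=> [r' Hr' ->]; apply: ore_deg_ltD; first exact: ore_deg_lt_mon.
exact: ore_deg_ltW Hr'.
Qed.

Lemma ore_top_coef n a p : ore_top n a (ore_eval p) -> a = p`_n.
Proof.
case=> _ [q sz_q ->];
  rewrite -ore_evalC -ore_evalMXn -ore_evalD => /ore_eval_inj ->.
by rewrite coefD coefMXn ltnn subnn coefC eqxx (nth_default _ sz_q) addr0.
Qed.

Lemma ore_top0 n a : ore_top n a 0 -> a = 0.
Proof. by rewrite -ore_eval0 => /ore_top_coef->; rewrite coef0. Qed.

Lemma ore_top_ex r : r != 0 -> exists n a, a != 0 /\ ore_top n a r.
Proof.
have [p ->] := ore_eval_surj r => nz_r.
have nz_p : p != 0 by apply: contra_neq nz_r => ->; rewrite ore_eval0.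
have sz_p : (0 < size p)%N by rewrite size_poly_gt0.
exists (size p).-1, (lead_coef p); split; first by rewrite lead_coef_eq0.
exists (ore_eval (\poly_(i < (size p).-1) p`_i)).
  by exists (\poly_(i < (size p).-1) p`_i); rewrite ?size_poly.
rewrite -ore_evalC -ore_evalMXn -ore_evalD; congr ore_eval.
apply/polyP=> i; rewrite coefD coefMXn coefC coef_poly.
case: ltngtP => lt_ip.
- by rewrite add0r.
- by rewrite subn_eq0 leqNgt lt_ip addr0 nth_default // -(prednK sz_p).
- by rewrite lt_ip subnn eqxx addr0 lead_coefE.
Qed.

Lemma ore_topC a : ore_top 0 a (iota a).
Proof. by exists 0; rewrite ?addr0 ?mulr1 //; apply: ore_deg_lt0. Qed.

Lemma ore_topD n a r s : ore_top n a r -> ore_deg_lt n s -> ore_top n a (r + s).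
Proof.
move=> [r' Hr' ->] Hs; exists (r' + s); first exact: ore_deg_ltD.
by rewrite addrA.
Qed.

Lemma ore_top_comm n a : ore_top n (iter n sigma a) (y ^+ n * iota a).
Proof.
elim: n => [|n [r Hr IH]]; first by rewrite mul1r; apply: ore_topC.
rewrite exprS -mulrA IH mulrDr mulrA ore_comm mulrDl -mulrA -exprS -addrA.
exists (iota (delta (iter n sigma a)) * y ^+ n + y * r) => //.
by apply: ore_deg_ltD; [apply: ore_deg_lt_mon | apply: ore_deg_lt_mulX_l].
Qed.

(** Moving [y ^+ m] past [b] gives sigma^m(b) up to lower degree; [delta] affects only the lower
    terms. *)
Lemma ore_topM m n a b r s :
  ore_top m a r -> ore_top n b s -> ore_top
    (m + n) (a * iter m sigma b) (r * s).
Proof.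
move=> [r' Hr' ->] Hs; rewrite mulrDl.
apply: ore_topD (ore_deg_ltM Hr' (ore_top_deg Hs)).
case: Hs => [s' Hs' ->]; rewrite mulrDr; apply: ore_topD; last first.
  by rewrite -mulrA; apply: ore_deg_lt_lmul; apply: ore_deg_lt_mulXn_l.
have [q Hq Eq] := ore_top_comm m b.
rewrite mulrA -[iota a * _ * _]mulrA Eq mulrDr mulrDl.
exists (iota a * q * y ^+ n).
  by apply: ore_deg_lt_mulXn; apply: ore_deg_lt_lmul.
by rewrite mulrA -rmorphM -mulrA -exprD.
Qed.

Lemma ore_ind (P : T -> Prop) :
    (forall r s, P r -> P s -> P (r + s)) ->
    (forall a n, P (iota a * y ^+ n)) ->
  forall r, P r.
Proof.
move=> PD Pmon r; have [p ->] := ore_eval_surj r; rewrite ore_evalE.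
apply: (big_ind P) => //; by rewrite -[0](mul0r (y ^+ 0)) -(rmorph0 iota).
Qed.

End OrePolynomials.

(** * Localization at a normal element *)

Section Localization.

Variables (R : nzRingType) (z : R) (S : nzRingType) (phi : {rmorphism R -> S}).
Hypothesis S_loc : localization (powers z) phi.
Hypothesis z_regular : forall r, r * z = 0 -> r = 0.
Hypothesis z_normal : forall r, exists r', r * z = z * r'.
Hypothesis z_normal' : forall r, exists r', z * r = r' * z.

Lemma regular_expr n r : r * z ^+ n = 0 -> r = 0.
Proof.
elim: n => [|n IH]; first by rewrite mulr1.
by rewrite exprSr mulrA => /z_regular.
Qed.

Lemma loc_phi_inj r : phi r = 0 -> r = 0.
Proof.
by case: S_loc => _ _ H /H [_ [[n ->]]]; apply: regular_expr.
Qed.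

Lemma loc_num q : exists r n, q * phi z ^+ n = phi r.
Proof.
case: S_loc => _ /(_ q) [r [_ [[n ->] E]]] _.
by exists r, n; rewrite -rmorphXn.
Qed.

Lemma loc_inv : exists w, phi z * w = 1 /\ w * phi z = 1.
Proof. by case: S_loc => H _ _; apply: H; exists 1%N. Qed.

Lemma normal_expr n r : exists r', r * z ^+ n = z ^+ n * r'.
Proof.
elim: n r => [|n IH] r; first by exists r; rewrite mul1r mulr1.
have [r1 E1] := IH r; have [r2 E2] := z_normal r1.
by exists r2; rewrite exprSr mulrA E1 -mulrA E2 mulrA.
Qed.

Lemma normal_expr' n r : exists r', z ^+ n * r = r' * z ^+ n.
Proof.
elim: n r => [|n IH] r; first by exists r; rewrite mul1r mulr1.
have [r1 E1] := z_normal' r; have [r2 E2] := IH r1.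
by exists r2; rewrite exprSr -mulrA E1 mulrA E2 mulrA.
Qed.

Lemma simple_loc_contains (K : R -> Prop) (r0 : R) :
  simple_ring S -> is_ideal K -> K r0 -> r0 != 0 -> exists n, K (z ^+ n).
Proof.
move=> S_simple KI Kr0 nz_r0.
(* Multiplying by powers of [z] on both sides makes [J] an ideal although [K]
   need not be stable under conjugation by [z]. *)
pose J (q : S) := exists k l r, K r /\ phi z ^+ k * q * phi z ^+ l = phi r.
have J_up k l q r k' l' : K r -> phi z ^+ k * q * phi z ^+ l = phi r ->
    exists2 r', K r' & phi z ^+ (k' + k) * q * phi z ^+ (l + l') = phi r'.
  move=> Kr E; exists (z ^+ k' * r * z ^+ l').
    by apply: (is_idealMr KI); apply: (is_idealMl KI).
  by rewrite !rmorphM !rmorphXn -E !exprD !mulrA.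
have [w [zw wz]] := loc_inv.
have J_phil r q : J q -> J (phi r * q).
  move=> [k [l [r1 [Kr1 E]]]]; have [r2 E2] := normal_expr' k r.
  exists k, l, (r2 * r1); split; first exact: (is_idealMl KI).
  by rewrite mulrA -rmorphXn -rmorphM E2 !rmorphM rmorphXn -E !mulrA.
have J_phir r q : J q -> J (q * phi r).
  move=> [k [l [r1 [Kr1 E]]]]; have [r2 E2] := normal_expr l r.
  exists k, l, (r1 * r2); split; first exact: (is_idealMr KI).
  have {}E2 : phi r * phi z ^+ l = phi z ^+ l * phi r2.
    by rewrite -rmorphXn -!rmorphM E2.
  by rewrite rmorphM -E -!mulrA E2.
have J_wl n q : J q -> J (w ^+ n * q).
  move=> [k [l [r1 [Kr1 E]]]]; exists (k + n)%N, l, r1; split=> //.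
  have zwn : phi z ^+ n * w ^+ n = 1.
    by rewrite -exprMn_comm ?zw ?expr1n // /GRing.comm zw wz.
  by rewrite exprD -E -!mulrA (mulrA (phi z ^+ n)) zwn mul1r.
have J_wr n q : J q -> J (q * w ^+ n).
  move=> [k [l [r1 [Kr1 E]]]]; exists k, (n + l)%N, r1; split=> //.
  have wzn : w ^+ n * phi z ^+ n = 1.
    by rewrite -exprMn_comm ?wz ?expr1n // /GRing.comm zw wz.
  by rewrite exprD -E !mulrA -(mulrA _ (w ^+ n)) wzn mulr1.
have frac q : exists r n, q = phi r * w ^+ n.
  have [r [n E]] := loc_num q; exists r, n; rewrite -E -mulrA.
  by rewrite -exprMn_comm ?zw ?expr1n ?mulr1 // /GRing.comm zw wz.
have JI : is_ideal J.
  split.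
  - by exists 0%N, 0%N, 0; rewrite !mulr1 mul1r rmorph0; split=> //;
    apply: is_ideal0 KI.
  - move=> a b [k [l [r [Kr E]]]] [k' [l' [r' [Kr' E']]]].
    have [s Ks Es] := J_up _ _ _ _ k' l' Kr E.
    have [s' Ks' Es'] := J_up _ _ _ _ k l Kr' E'.
    exists (k' + k)%N, (l + l')%N, (s - s'); split; first exact: (is_idealB KI).
    by rewrite mulrBr mulrBl Es rmorphB -Es' (addnC k) (addnC l).
  - by move=> q a Ja; have [r [n ->]] := frac q; rewrite -mulrA;
    apply/J_phil/J_wl.
  - by move=> q a Ja; have [r [n ->]] := frac q; rewrite mulrA;
    apply/J_wr/J_phir.
case: (S_simple J JI) => [J0 | /(_ 1) [k [l [r [Kr E]]]]].
  case/negP: nz_r0; apply/eqP; apply: loc_phi_inj; apply/J0.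
  by exists 0%N, 0%N, r0; rewrite mulr1 mul1r.
(* That 1 lies in [J] says that phi(z)^(k+l) is the image of an element of [K]; [phi] is injective
   because [z] is regular. *)
exists (k + l)%N; suff -> : z ^+ (k + l) = r by [].
apply/eqP; rewrite -subr_eq0; apply/eqP; apply: loc_phi_inj.
by rewrite rmorphB rmorphXn exprD -E mulr1 subrr.
Qed.

(** Clearing denominators shows that a nonzero ideal of [S] contracts to a nonzero ideal of [R]; a
    power of [z] in the contraction is a unit of [S]. *)
Lemma loc_simple :
    (forall (K : R -> Prop) (r0 : R),
       is_ideal K -> K r0 -> r0 != 0 -> exists n, K (z ^+ n)) ->
  simple_ring S.
Proof.
move=> H J JI; case: (classic (exists2 q, J q & q != 0)) => [[q Jq nz_q]|J0];
  last first.
  left=> a; split=> [Ja|->]; last exact: is_ideal0 JI.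
  by apply/eqP/negPn/negP => nz_a; apply: J0; exists a.
right=> a; have [w [zw wz]] := loc_inv.
have zwn n : phi z ^+ n * w ^+ n = 1.
  by rewrite -exprMn_comm ?zw ?expr1n // /GRing.comm zw wz.
have [r [n E]] := loc_num q.
have [|||m Jz] := H (fun r => J (phi r)) r.
- split=> [|b c|s b|s b]; rewrite ?rmorph0 ?rmorphB ?rmorphM.
  + exact: is_ideal0.
  + exact: is_idealB.
  + exact: is_idealMl.
  + exact: is_idealMr.
- by rewrite -E; apply: is_idealMr.
- apply: contra_neq nz_q => r0; move: E; rewrite r0 rmorph0.
  by move/(congr1 (fun t => t * w ^+ n)); rewrite -mulrA zwn mulr1 mul0r.
by rewrite -[a]mul1r -(zwn m); do 2!apply: is_idealMr => //; rewrite -rmorphXn.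
Qed.

End Localization.

(** * Ambiskew polynomial rings *)

Section Ambiskew.

Variables (F : fieldType) (A : algType F) (rho : F).
Hypothesis rho_neq0 : rho != 0.
Variables (alpha gamma : algAut A).
Hypothesis alpha_gamma : forall a, alpha (gamma a) = gamma (alpha a).
Variables (v : A) (T : nzRingType) (iA : {rmorphism A -> T}) (y : T).
Variables (beta : {rmorphism T -> T}) (delta : T -> T).
Variables (R : nzRingType) (iT : {rmorphism T -> R}) (x : R).
Hypothesis R_ambiskew : ambiskew_ring alpha gamma v rho iA y beta delta iT x.
Variable u : A.
Hypothesis u_splitting : splitting_element alpha gamma v rho u.

Let T_ore : ore_extension alpha (fun=> 0) iA y := ambiskew_inner R_ambiskew.
Let R_ore : ore_extension beta delta iT x := ambiskew_outer R_ambiskew.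
Let betaA (a : A) : A := aut_inv alpha (gamma a).

Let jA (a : A) : R := iT (iA a).
(** [R] is only a ring here, so scalars enter as elements; [sc_central] shows that they are
    central. *)
Let sc (k : F) : R := jA k%:A.
Let Y : R := iT y.
Variable z : R.
Hypothesis z_def : z = x * Y - jA u.

(** * Commutation relations and normality of the Casimir element *)

Lemma gamma_u : gamma u = u.
Proof. by case: u_splitting => -[]. Qed.

Lemma u_comm a : u * a = gamma a * u.
Proof. by case: u_splitting => -[]. Qed.

Lemma v_def : v = u - rho *: alpha u.
Proof. by case: u_splitting. Qed.

Lemma aut_invV_comm a : gamma (aut_inv alpha a) = aut_inv alpha (gamma a).
Proof. by rewrite -{2}[a](autVK alpha) -alpha_gamma autK. Qed.

Lemma alpha_inj : injective alpha. Proof. exact: can_inj (autK alpha). Qed.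
Lemma alpha_betaA a : alpha (betaA a) = gamma a.
Proof. exact: autVK. Qed.

Lemma betaA_alpha a : betaA (alpha a) = gamma a.
Proof. by rewrite /betaA -alpha_gamma autK. Qed.

Lemma jAZ k a : jA (k *: a) = sc k * jA a.
Proof. by rewrite /sc /jA -!rmorphM -scalerAl mul1r. Qed.

Lemma scM k l : sc k * sc l = sc (k * l).
Proof. by rewrite /sc /jA -!rmorphM -scalerAl mul1r scalerA. Qed.

Lemma sc1 : sc 1 = 1.
Proof. by rewrite /sc /jA scale1r !rmorph1. Qed.

Lemma y_iA a : y * iA a = iA (alpha a) * y.
Proof. by rewrite (ore_comm T_ore) rmorph0 addr0. Qed.

Lemma Y_jA a : Y * jA a = jA (alpha a) * Y.
Proof. by rewrite -!rmorphM y_iA. Qed.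

Lemma x_jA a : x * jA a = jA (betaA a) * x.
Proof.
rewrite (ore_comm R_ore) (ambiskew_betaA R_ambiskew) (ambiskew_deltaA
  R_ambiskew).
by rewrite rmorph0 addr0.
Qed.

Lemma sc_jA k a : jA a * sc k = sc k * jA a.
Proof. by rewrite /sc /jA -!rmorphM -scalerAl mul1r -scalerAr mulr1. Qed.

Lemma sc_Y k : Y * sc k = sc k * Y.
Proof. by rewrite Y_jA linearZ rmorph1. Qed.

Lemma sc_x k : x * sc k = sc k * x.
Proof.
by rewrite x_jA /betaA linearZ rmorph1 -{1}(rmorph1 alpha) -linearZ autK.
Qed.

(** Reduces centrality, normality and stability claims to the generators of [R]. *)
Lemma ambiskew_gen (P : R -> Prop) :
    (forall a, P (jA a)) -> P Y -> P x ->
    (forall r s, P r -> P s -> P (r + s)) ->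
    (forall r s, P r -> P s -> P (r * s)) ->
  forall r, P r.
Proof.
move=> PA PY Px PD PM.
have P1 : P 1 by have := PA 1; rewrite /jA !rmorph1.
have PX r n : P r -> P (r ^+ n).
  by move=> Pr; elim: n => [|n IH]; rewrite ?exprS //; apply: (PM).
apply: (ore_ind R_ore) => // t n; apply: (PM); last exact: PX.
elim/(ore_ind T_ore): t => [r s Pr Ps|a m]; first by rewrite rmorphD; apply: PD.
by rewrite rmorphM rmorphXn; apply: (PM); [apply: PA | apply: PX].
Qed.

Lemma sc_central k r : r * sc k = sc k * r.
Proof.
elim/ambiskew_gen: r => [a|||r s Er Es|r s Er Es].
- exact: sc_jA.
- exact: sc_Y.
- exact: sc_x.
- by rewrite mulrDl mulrDr Er Es.
- by rewrite -mulrA Es mulrA Er mulrA.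
Qed.

Lemma xY : x * Y = z + jA u.
Proof. by rewrite z_def subrK. Qed.

Lemma z_eq : z = sc rho * Y * x - sc rho * jA (alpha u).
Proof.
have jv : jA v = jA u - sc rho * jA (alpha u)
  by rewrite v_def -jAZ /jA !rmorphB.
rewrite z_def (ore_comm R_ore) (ambiskew_beta_y R_ambiskew).
rewrite (ambiskew_delta_y R_ambiskew) rmorphM /= -/(jA v) -/Y -/(sc rho) jv.
by rewrite addrA addrAC addrK.
Qed.

Lemma sc_unitl k r : k != 0 -> sc k^-1 * (sc k * r) = r.
Proof. by move=> k0; rewrite mulrA scM mulVf // sc1 mul1r. Qed.

Lemma Yx : Y * x = sc rho^-1 * z + jA (alpha u).
Proof. by rewrite z_eq mulrBr -!mulrA !sc_unitl // subrK. Qed.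

Lemma z_jA a : z * jA a = jA (gamma a) * z.
Proof.
rewrite z_def mulrBl mulrBr -mulrA Y_jA !mulrA x_jA betaA_alpha -mulrA.
by rewrite -[jA u * _]rmorphM -[jA _ * jA u]rmorphM -!rmorphM u_comm.
Qed.

(** Both forms of [z] are used: expanding it as rho(Yx - alpha(u)) produces [x * Y], which is z + u,
    and the terms in u cancel by the rule for [Y]. *)
Lemma z_Y : z * Y = sc rho * Y * z.
Proof.
by rewrite {1}z_eq mulrBl -!mulrA xY -Y_jA !mulrDr addrK.
Qed.

Lemma x_z : x * z = sc rho * z * x.
Proof.
rewrite {1}z_eq mulrBr !mulrA !sc_x -!mulrA x_jA betaA_alpha gamma_u.
by rewrite -mulrBr (mulrA x) -mulrBl -z_def mulrA.
Qed.

Lemma z_x : z * x = sc rho^-1 * x * z.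
Proof. by rewrite -mulrA x_z -mulrA sc_unitl. Qed.

Lemma Y_z : Y * z = sc rho^-1 * z * Y.
Proof. by rewrite -mulrA z_Y -mulrA sc_unitl. Qed.

Lemma z_normal r : exists r', r * z = z * r'.
Proof.
elim/ambiskew_gen: r => [a|||r s [r' Er] [s' Es]|r s [r' Er] [s' Es]].
- by exists (jA (aut_inv gamma a)); rewrite z_jA autVK.
- by exists (sc rho^-1 * Y); rewrite Y_z mulrA sc_central.
- by exists (sc rho * x); rewrite x_z mulrA sc_central.
- by exists (r' + s'); rewrite mulrDl mulrDr Er Es.
- by exists (r' * s'); rewrite -mulrA Es (mulrA r) Er -mulrA.
Qed.

Lemma z_normal' r : exists r', z * r = r' * z.
Proof.
elim/ambiskew_gen: r => [a|||r s [r' Er] [s' Es]|r s [r' Er] [s' Es]].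
- by exists (jA (gamma a)); rewrite z_jA.
- by exists (sc rho * Y); rewrite z_Y.
- by exists (sc rho^-1 * x); rewrite z_x.
- by exists (r' + s'); rewrite mulrDl mulrDr Er Es.
- by exists (r' * s'); rewrite (mulrA z) Er -mulrA Es mulrA.
Qed.

Lemma Yn_jA n a : Y ^+ n * jA a = jA (iter n alpha a) * Y ^+ n.
Proof.
elim: n => [|n IH]; first by rewrite mul1r mulr1.
by rewrite exprS -mulrA IH mulrA Y_jA -mulrA.
Qed.

Lemma zn_jA n a : z ^+ n * jA a = jA (iter n gamma a) * z ^+ n.
Proof.
elim: n => [|n IH]; first by rewrite mul1r mulr1.
by rewrite exprS -mulrA IH mulrA z_jA -mulrA.
Qed.

Lemma q_commX (k : F) (a b : R) n : b * a = sc k * a * b ->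
  b * a ^+ n = sc (k ^+ n) * a ^+ n * b.
Proof.
move=> E; elim: n => [|n IH]; first by rewrite sc1 !mulr1 mul1r.
rewrite exprSr mulrA IH -mulrA E exprSr -scM !mulrA -(mulrA _ (a ^+ n)).
by rewrite sc_central !mulrA.
Qed.

Lemma q_commX' (k : F) (a b : R) n : b * a = sc k * a * b ->
  b ^+ n * a = sc (k ^+ n) * a * b ^+ n.
Proof.
move=> E; elim: n => [|n IH]; first by rewrite sc1 !mulr1 !mul1r.
rewrite exprSr -mulrA E !mulrA sc_central -!mulrA (mulrA _ a) IH exprS -scM.
by rewrite !mulrA.
Qed.

(** * Leading terms in [x] and regular elements *)

Definition ymon (k : F) (n : nat) : T := iA k%:A * y ^+ n.

Lemma iA_sc_comm k t : t * iA k%:A = iA k%:A * t.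
Proof.
elim/(ore_ind T_ore): t => [r s Er Es|a n];
  first by rewrite mulrDl mulrDr Er Es.
elim: n => [|n IH]; last first.
  by rewrite exprSr -!mulrA y_iA linearZ rmorph1 !mulrA IH !mulrA.
by rewrite !mulr1 -!rmorphM -scalerAr -scalerAl mulr1 mul1r.
Qed.

Lemma ymonM k l m n : ymon k m * ymon l n = ymon (k * l) (m + n)%N.
Proof.
rewrite /ymon mulrA -(mulrA _ (y ^+ m)) iA_sc_comm !mulrA -rmorphM -scalerAl
  mul1r.
by rewrite scalerA -mulrA exprD.
Qed.

Lemma mulr_ymon_eq0 k n t : k != 0 -> t * ymon k n = 0 -> t = 0.
Proof.
move=> k0; rewrite /ymon mulrA iA_sc_comm -mulrA => E.
have {}E : t * y ^+ n = 0.
  have unitl w : iA (k^-1)%:A * (iA k%:A * w) = w.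
    by rewrite mulrA -rmorphM -scalerAl mul1r scalerA mulVf // scale1r
      rmorph1 mul1r.
  by rewrite -[LHS]unitl E mulr0.
have [p Ep] := ore_eval_surj T_ore t; move: E; rewrite Ep -ore_evalMXn.
rewrite -(ore_eval0 iA y) => /(ore_eval_inj T_ore) pX0.
suff -> : p = 0 by [].
apply/polyP=> i; have := coef0 A (i + n)%N;
  rewrite -{1}pX0 coefMXn ltnNge leq_addl addnK.
by rewrite coef0.
Qed.

(** A leading coefficient a of [t] in [y] becomes k alpha^n(a), which is nonzero since alpha is
    injective. *)
Lemma ymon_mulr_eq0 k n t : k != 0 -> ymon k n * t = 0 -> t = 0.
Proof.
move=> k0 E; apply/eqP/negPn/negP => nz_t.
have [m [a [nz_a top_a]]] := ore_top_ex T_ore nz_t.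
have top_ymon : ore_top iA y n k%:A (ymon k n).
  by exists 0; rewrite ?addr0 //; apply: ore_deg_lt0.
have := ore_topM T_ore top_ymon top_a; rewrite E => /(ore_top0 T_ore).
rewrite -scalerAl mul1r => /eqP; rewrite scaler_eq0 (negPf k0) /=.
suff inj : injective (iter n alpha).
  by rewrite -[0](iter_fix n (rmorph0 alpha)) (inj_eq inj) (negPf nz_a).
by elim: n {E top_ymon} => [//|n IH]; apply: inj_comp alpha_inj IH.
Qed.

(** Since beta only rescales powers of [y], the leading coefficients of powers of [z] remain nonzero
    scalar multiples of powers of [y]. *)
Lemma iter_beta_ymon m k n
  : iter m beta (ymon k n) = ymon (k * rho ^+ n ^+ m) n.
Proof.
have beta_ymon l : beta (ymon l n) = ymon (l * rho ^+ n) n.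
  rewrite /ymon rmorphM rmorphXn (ambiskew_beta_y R_ambiskew).
  rewrite (ambiskew_betaA R_ambiskew) linearZ rmorph1.
  rewrite -{1}(rmorph1 alpha) -linearZ autK exprMn_comm; last first.
    by rewrite /GRing.comm iA_sc_comm.
  rewrite mulrA -rmorphXn -rmorphM; congr (iA _ * _).
  by rewrite -scalerAl mul1r exprZn expr1n scalerA.
by elim: m => [|m /= ->]; rewrite ?mulr1 // beta_ymon -mulrA -exprSr.
Qed.

Lemma z_top : ore_top iT x 1 (ymon rho 1) z.
Proof.
rewrite z_eq; apply: ore_topD; first by exists 0;
  rewrite ?addr0 -?rmorphM //; apply: ore_deg_lt0.
rewrite -rmorphM -rmorphN -[iT _]mulr1 -(expr0 x).
exact: ore_deg_lt_mon.
Qed.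

Lemma zn_top n : exists k, k != 0 /\ ore_top iT x n (ymon k n) (z ^+ n).
Proof.
elim: n => [|n [k [k0 Hk]]].
  exists 1; rewrite oner_neq0; split=> //.
  have -> : ymon 1 0 = 1 by rewrite /ymon scale1r rmorph1 mulr1.
  by rewrite expr0 -(rmorph1 iT); apply: ore_topC.
have := ore_topM R_ore Hk z_top; rewrite iter_beta_ymon ymonM addn1 -exprSr.
by move=> H; eexists; split; last exact: H; rewrite !mulf_neq0 ?expf_neq0.
Qed.

Lemma z_regular r : r * z = 0 -> r = 0.
Proof.
move=> E; apply/eqP/negPn/negP => nz_r.
have [n [t [/negP nz_t top_t]]] := ore_top_ex R_ore nz_r; apply: nz_t.
have := ore_topM R_ore top_t z_top; rewrite E => /(ore_top0 R_ore).
rewrite iter_beta_ymon => /mulr_ymon_eq0 -> //.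
by rewrite mulf_neq0 ?expf_neq0.
Qed.

Lemma Y_regular r n : r * Y ^+ n = 0 -> r = 0.
Proof.
move=> E; apply/eqP/negPn/negP => nz_r.
have [m [t [/negP nz_t top_t]]] := ore_top_ex R_ore nz_r; apply: nz_t.
have Yn : Y ^+ n = iT (ymon 1 n)
  by rewrite /ymon scale1r rmorph1 mul1r rmorphXn.
have := ore_topM R_ore top_t (ore_topC iT x (ymon 1 n)).
rewrite -Yn E => /(ore_top0 R_ore).
rewrite iter_beta_ymon => /mulr_ymon_eq0 -> //.
by rewrite mulf_neq0 ?expf_neq0 ?oner_neq0.
Qed.

(** * Monomials in [Y] and [z] *)

Definition mon (i k : nat) : R := Y ^+ i * z ^+ k.

Lemma mon_jA i k a :
  mon i k * jA a = jA (iter i alpha (iter k gamma a)) * mon i k.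
Proof. by rewrite /mon -mulrA zn_jA mulrA Yn_jA mulrA. Qed.

Lemma mon_z i k : mon i k * z = mon i k.+1.
Proof. by rewrite /mon -mulrA -exprSr. Qed.

Lemma Y_mon i k : Y * mon i k = mon i.+1 k.
Proof. by rewrite /mon mulrA -exprS. Qed.

Lemma z_mon i k : z * mon i k = sc (rho ^+ i) * mon i k.+1.
Proof. by rewrite /mon mulrA (q_commX _ z_Y) -!mulrA -exprS. Qed.

Lemma mon_Y i k : mon i k * Y = sc (rho ^+ k) * mon i.+1 k.
Proof.
by rewrite /mon -mulrA (q_commX' _ z_Y) -!mulrA (mulrA (Y ^+ i)) sc_central
  exprSr !mulrA.
Qed.

(** The right factor [Y], moved to the front, merges with [x] into z + u, so the product stays in
    the span of the monomials. *)
Lemma x_mon_Y i k :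
  x * mon i k * Y
  = sc (rho ^+ (i + k)) * mon i k.+1 + sc (rho ^+ k) * jA u * mon i k.
Proof.
rewrite -mulrA mon_Y mulrA sc_central -mulrA -Y_mon (mulrA x) xY mulrDl.
by rewrite z_mon mulrDr !mulrA scM -exprD addnC.
Qed.

(** The [N] slots are placed in the exponent grid by [e], so that the number of terms can be
    minimized and two sums with the same [e] compared slot by slot. *)
Definition mon_sum (N : nat) (e : 'I_N -> nat * nat) (c : 'I_N -> A) : R :=
  \sum_l jA (c l) * mon (e l).1 (e l).2.

Lemma zu_Yn n :
  (z + jA u) * Y ^+ n
  = Y ^+ n * (sc (rho ^+ n) * z + jA (iter n (aut_inv alpha) u)).
Proof.
have E : iter n alpha (iter n (aut_inv alpha) u) = u.
  by elim: n => // n IH; rewrite iterSr iterS autVK.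
by rewrite mulrDl (q_commX _ z_Y) mulrDr Yn_jA E mulrA sc_central.
Qed.

(** Each [Y] absorbs one [x]: x^(n+1) Y^(n+1) equals x^n Y^n times rho^n z + alpha^-n(u). *)
Lemma mul_Yn_pos r : exists n q, r * Y ^+ n = ore_eval iT z q.
Proof.
pose pos r := exists q, r = ore_eval iT z q.
have pos0 : pos 0 by exists 0; rewrite ore_eval0.
have posD r1 r2 : pos r1 -> pos r2 -> pos (r1 + r2).
  by move=> [q1 ->] [q2 ->]; exists (q1 + q2); rewrite ore_evalD.
have pos_sum n (f : 'I_n -> R) : (forall i, pos (f i)) -> pos (\sum_i f i).
  by move=> pf; apply: (big_ind pos).
have pos_mon t n : pos (iT t * z ^+ n).
  by exists (t%:P * 'X^n); rewrite ore_evalMXn ore_evalC.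
have pos_l t r1 : pos r1 -> pos (iT t * r1).
  by move=> [q ->]; exists (t%:P * q); rewrite ore_eval_lmul.
have pos_z r1 : pos r1 -> pos (r1 * z).
  by move=> [q ->]; exists (q * 'X); rewrite ore_evalMX.
have pos_jA a r1 : pos r1 -> pos (r1 * jA a).
  move=> [q ->]; rewrite ore_evalE mulr_suml; apply: pos_sum => i.
  by rewrite -mulrA zn_jA mulrA -rmorphM.
have pos_Y r1 : pos r1 -> pos (r1 * Y).
  move=> [q ->]; rewrite ore_evalE mulr_suml; apply: pos_sum => i.
  by rewrite -mulrA (q_commX' _ z_Y) !mulrA -!rmorphM.
have pos_xY n : pos (x ^+ n * Y ^+ n).
  elim: n => [|n IH]; first by have := pos_mon 1 0;
    rewrite rmorph1 !expr0 mulr1.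
  rewrite exprSr exprS -mulrA (mulrA x) xY zu_Yn mulrA mulrDr.
  by apply: posD; rewrite ?mulrA; [apply/pos_z/pos_jA | apply/pos_jA].
have [p ->] := ore_eval_surj R_ore r.
(* [size p] exceeds every exponent of [x], so x^i meets at least i factors [Y]; the surplus ones are
   handled by [pos_Y]. *)
exists (size p); change (pos (ore_eval iT x p * Y ^+ size p)).
rewrite ore_evalE mulr_suml; apply: pos_sum => i; rewrite -mulrA; apply: pos_l.
have -> : Y ^+ size p = Y ^+ i * Y ^+ (size p - i)
  by rewrite -exprD subnKC // ltnW.
rewrite mulrA.
by elim: (_ - _)%N => [|n IH]; rewrite ?mulr1 // exprSr mulrA; apply: pos_Y.
Qed.

Lemma ore_eval_mon_sum q :
  exists N (e : 'I_N -> nat * nat) c, injective e /\ ore_eval iT z q =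
    mon_sum e c.
Proof.
have surj t : exists p, t == ore_eval iA y p.
  by have [p ->] := ore_eval_surj T_ore t; exists p.
pose co t := xchoose (surj t).
have coE t : t = ore_eval iA y (co t) by apply/eqP; apply: (xchooseP (surj t)).
(* A common bound for the degrees in [y] lets the slots fill a whole rectangle, where injectivity of
   the exponents is that of [enum_val]. *)
pose m := \max_(k < size q) size (co (q`_k)%R).
pose ev (l : 'I_#|{: 'I_m * 'I_(size q)}|) : 'I_m * 'I_(size q) := enum_val l.
have ev_bij : bijective ev by apply: enum_val_bij.
exists #|{: 'I_m * 'I_(size q)}|, (fun l => (val (ev l).1, val (ev l).2)).
exists (fun l => (co (q`_(ev l).2)%R)`_(ev l).1); split.
  move=> l l' [/val_inj E1 /val_inj E2]; apply: (bij_inj ev_bij).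
  by rewrite [LHS]surjective_pairing E1 E2 -surjective_pairing.
pose G (d : 'I_m * 'I_(size q)) := jA ((co q`_d.2)`_d.1) * mon d.1 d.2.
rewrite -[RHS](reindex ev (P := predT) (F := G)) /=; last exact: onW_bij.
rewrite -(pair_bigA _ (fun (i : 'I_m) (k
  : 'I_(size q)) => jA ((co q`_k)`_i) * mon i k)) /=.
rewrite exchange_big ore_evalE; apply: eq_bigr => k _ /=.
rewrite {1}[q`_k]coE /ore_eval (@horner_coef_wide _ m); last first.
  by rewrite (leq_trans (size_poly _ _)) //; apply: (leq_bigmax k).
rewrite rmorph_sum mulr_suml; apply: eq_bigr => i _.
by rewrite coef_map rmorphM rmorphXn /mon mulrA.
Qed.

(** * Iterated automorphisms, the elements v^(m), and units of [A] *)

Lemma autZ (f : algAut A) k a : f (k *: a) = k *: f a.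
Proof. exact: linearZ. Qed.

Lemma autB (f : algAut A) a b : f (a - b) = f a - f b.
Proof. exact: rmorphB. Qed.

Lemma autM (f : algAut A) a b : f (a * b) = f a * f b.
Proof. exact: rmorphM. Qed.

Lemma iter_autD (f : algAut A) n a b
  : iter n f (a + b) = iter n f a + iter n f b.
Proof. by elim: n => //= n ->; rewrite rmorphD. Qed.

Lemma iter_autB (f : algAut A) n a b
  : iter n f (a - b) = iter n f a - iter n f b.
Proof. by elim: n => //= n ->; rewrite rmorphB. Qed.

Lemma iter_autM (f : algAut A) n a b
  : iter n f (a * b) = iter n f a * iter n f b.
Proof. by elim: n => //= n ->; rewrite rmorphM. Qed.

Lemma iter_autZ (f : algAut A) n k a : iter n f (k *: a) = k *: iter n f a.
Proof. by elim: n => //= n ->; rewrite autZ. Qed.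

Lemma iter_aut0 (f : algAut A) n : iter n f 0 = 0.
Proof. by elim: n => //= n ->; rewrite rmorph0. Qed.

Lemma iter_aut1 (f : algAut A) n : iter n f 1 = 1.
Proof. by elim: n => //= n ->; rewrite rmorph1. Qed.

Lemma iter_autX (f : algAut A) n m a : iter n f (a ^+ m) = iter n f a ^+ m.
Proof. by elim: n => //= n ->; rewrite rmorphXn. Qed.

Lemma iter_autVK (f : algAut A) n : cancel (iter n (aut_inv f)) (iter n f).
Proof. by elim: n => // n IH a; rewrite iterSr iterS autVK. Qed.

Lemma iter_autK (f : algAut A) n : cancel (iter n f) (iter n (aut_inv f)).
Proof. by elim: n => // n IH a; rewrite iterSr iterS autK. Qed.

(** Evaluated at a point of the form f^n(a), an integer power in [special] becomes a natural
    iterate. *)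
Lemma aut_exp_subz (f : algAut A) (m n : nat) a :
  aut_exp f (m%:Z - n%:Z) (iter n f a) = iter m f a.
Proof.
case: (leqP n m) => [le_nm | lt_mn].
  by rewrite subzn //= -iterD subnK.
rewrite -opprB subzn 1?ltnW //.
have -> : - (n - m)%N%:Z = Negz (n - m).-1 by rewrite NegzE prednK // subn_gt0.
rewrite /aut_exp prednK ?subn_gt0 // -{2}(subnK (ltnW lt_mn)) iterD.
exact: iter_autK.
Qed.

Lemma iter_alpha_gamma n a : iter n alpha (gamma a) = gamma (iter n alpha a).
Proof. by elim: n => //= n ->. Qed.

Lemma iter_alpha_iter_gamma m n a :
  iter m alpha (iter n gamma a) = iter n gamma (iter m alpha a).
Proof. by elim: n => //= n <-; rewrite iter_alpha_gamma. Qed.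

(** The sum telescopes because v = u - rho alpha(u). *)
Lemma v_sumE m : v_sum alpha v rho m = u - rho ^+ m *: iter m alpha u.
Proof.
elim: m => [|m IH]; first by rewrite /v_sum big_geq // scale1r subrr.
rewrite /v_sum big_nat_recr //= -/(v_sum _ _ _ _) IH v_def iter_autB iter_autZ.
by rewrite scalerBr scalerA -exprSr addrA subrK -iterSr.
Qed.

Lemma gamma_v_sum m : gamma (v_sum alpha v rho m) = v_sum alpha v rho m.
Proof. by rewrite v_sumE autB autZ -iter_alpha_gamma gamma_u. Qed.

(** Both u and alpha^m(u) obey this rule, as alpha and gamma commute; with [gamma_v_sum], v^(m) is
    gamma-normal. *)
Lemma v_sum_comm m a :
  v_sum alpha v rho m * a = gamma a * v_sum alpha v rho m.
Proof.
rewrite v_sumE mulrBl mulrBr u_comm -scalerAl -scalerAr; congr (_ - _ *: _).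
rewrite -{1}[a](iter_autVK alpha m) -iter_autM u_comm iter_autM.
by rewrite iter_alpha_gamma iter_autVK.
Qed.

(** The right ideal cA is two-sided by the commutation hypothesis, and {alpha, gamma}-stable because
    c is a common eigenvector. *)
Lemma normal_unit c :
    simple_under2 alpha gamma -> c <> 0 ->
    (forall a, exists a', a * c = c * a') ->
    (exists k, alpha c = k *: c) -> (exists k, gamma c = k *: c) ->
  exists b, c * b = 1.
Proof.
move=> A_simple nz_c c_normal [k Ek] [l El].
pose I a := exists b, a = c * b.
have II : is_ideal I.
  split; first by exists 0; rewrite mulr0.
  - by move=> _ _ [a ->] [b ->]; exists (a - b); rewrite mulrBr.
  - move=> r _ [a ->]; have [r' E] := c_normal r.
    by exists (r' * a); rewrite (mulrA r) E -mulrA.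
  - by move=> r _ [a ->]; exists (a * r); rewrite mulrA.
have [||I0 | I1] := A_simple I II.
- by move=> _ [a ->]; exists (k *: alpha a); rewrite autM Ek -scalerAl scalerAr.
- by move=> _ [a ->]; exists (l *: gamma a); rewrite autM El -scalerAl scalerAr.
- by case: nz_c; apply/I0; exists 1; rewrite mulr1.
by have [b ->] := I1 1; exists b.
Qed.

Lemma jA0 : jA 0 = 0. Proof. by rewrite /jA !rmorph0. Qed.
Lemma jA1 : jA 1 = 1. Proof. by rewrite /jA !rmorph1. Qed.
Lemma jAN a : jA (- a) = - jA a. Proof. by rewrite /jA !rmorphN. Qed.
Lemma jAB a b : jA (a - b) = jA a - jA b. Proof. by rewrite /jA !rmorphB. Qed.
Lemma jAM a b : jA (a * b) = jA a * jA b. Proof. by rewrite /jA !rmorphM. Qed.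

(** * Multiplication of sums of monomials by the generators *)

Section MonSum.

Variables (N : nat) (e : 'I_N -> nat * nat).
Implicit Types c d : 'I_N -> A.

Definition shift s t (l : 'I_N) := (((e l).1 + s)%N, ((e l).2 + t)%N).

Lemma shift_inj s t : injective e -> injective (shift s t).
Proof.
move=> e_inj l l' [/addIn E1 /addIn E2]; apply: e_inj.
by rewrite [LHS]surjective_pairing E1 E2 -surjective_pairing.
Qed.

Lemma eq_mon_sum (e' : 'I_N -> nat * nat) c d :
  e =1 e' -> c =1 d -> mon_sum e c = mon_sum e' d.
Proof. by move=> Ee Ec; apply: eq_bigr => l _; rewrite Ee Ec. Qed.

Lemma mon_sum0 : mon_sum e (fun=> 0) = 0.
Proof. by apply: big1 => l _; rewrite jA0 mul0r. Qed.

Lemma mon_sumB c d : mon_sum e c - mon_sum e d = mon_sum e (fun l => c l - d l).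
Proof. by rewrite -sumrB; apply: eq_bigr => l _; rewrite jAB mulrBl. Qed.

Lemma mon_sumM a c : jA a * mon_sum e c = mon_sum e (fun l => a * c l).
Proof. by rewrite mulr_sumr; apply: eq_bigr => l _; rewrite mulrA -jAM. Qed.

Lemma mon_sumZ k c : sc k * mon_sum e c = mon_sum e (fun l => k *: c l).
Proof. by rewrite mulr_sumr; apply: eq_bigr => l _; rewrite jAZ mulrA. Qed.

Lemma mon_sum_mulr c a : mon_sum e c * jA a
  = mon_sum e (fun l => c l * iter (e l).1 alpha (iter (e l).2 gamma a)).
Proof.
by rewrite mulr_suml; apply: eq_bigr => l _; rewrite -mulrA mon_jA mulrA -jAM.
Qed.

Lemma mon_sum_z c : mon_sum e c * z = mon_sum (shift 0 1) c.
Proof.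
rewrite mulr_suml; apply: eq_bigr => l _.
by rewrite -mulrA mon_z /shift /= addn0 addn1.
Qed.

Lemma z_mon_sum c :
  z * mon_sum e c
  = mon_sum (shift 0 1) (fun l => rho ^+ (e l).1 *: gamma (c l)).
Proof.
rewrite mulr_sumr; apply: eq_bigr => l _.
by rewrite mulrA z_jA -mulrA z_mon mulrA sc_jA jAZ /shift /= addn0 addn1.
Qed.

Lemma mon_sum_Y c :
  mon_sum e c * Y = mon_sum (shift 1 0) (fun l => rho ^+ (e l).2 *: c l).
Proof.
rewrite mulr_suml; apply: eq_bigr => l _.
by rewrite -mulrA mon_Y mulrA sc_jA jAZ /shift /= addn0 addn1.
Qed.

Lemma Y_mon_sum c :
  Y * mon_sum e c = mon_sum (shift 1 0) (fun l => alpha (c l)).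
Proof.
rewrite mulr_sumr; apply: eq_bigr => l _.
by rewrite mulrA Y_jA -mulrA Y_mon /shift /= addn0 addn1.
Qed.

Lemma x_mon_sum_Y c : x * mon_sum e c * Y
  = mon_sum (shift 0 1) (fun l => rho ^+ ((e l).1 + (e l).2) *: betaA (c l))
    + mon_sum e (fun l => rho ^+ (e l).2 *: (betaA (c l) * u)).
Proof.
rewrite mulr_sumr mulr_suml -big_split; apply: eq_bigr => l _ /=.
have -> m : x * (jA (c l) * m) * Y = jA (betaA (c l)) * (x * m * Y).
  by rewrite mulrA x_jA !mulrA.
have E1 k b m : jA b * (sc k * m) = jA (k *: b) * m by rewrite jAZ mulrA sc_jA.
by rewrite x_mon_Y mulrDr -[sc _ * jA u * _]mulrA !E1 [_ * (_ * mon _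
  _)]mulrA -jAM
   -scalerAl /shift /= addn0 addn1.
Qed.

End MonSum.

(** * Sufficiency *)

Section IdealContainsPower.

Variable K : R -> Prop.
Hypothesis K_ideal : is_ideal K.
Hypothesis A_simple : simple_under2 alpha gamma.
Hypothesis u_not_nilpotent : ~ exists n : nat, u ^+ n = 0.
Hypothesis no_special :
  ~ exists j : int, j <> 0 /\ exists c : A, special alpha gamma rho 0 j c.
Hypothesis v_sum_divides : forall m : nat, (1 <= m)%N ->
  exists (n : nat) (a : A), u ^+ n = v_sum alpha v rho m * a.

Lemma sc_swap k r s : r * (sc k * s) = sc k * (r * s).
Proof. by rewrite mulrA sc_central -mulrA. Qed.

Let K_scal k r : k != 0 -> K (sc k * r) -> K r.
Proof. by move=> k0 /(is_idealMl K_ideal (sc k^-1)); rewrite sc_unitl. Qed.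

(** * Elements of [K] with the fewest terms *)

Section Minimal.

Variables (N : nat).
(** Brings two elements of [K] to a common shift so that they can be subtracted. Right
    multiplication by [Y] scales each slot by a power of rho; dividing by the one at [l0] restores
    that coefficient. *)
Lemma shift_up (e : 'I_N -> nat * nat) c l0 s t s' t' :
    K (mon_sum (shift e s t) c) ->
  exists2 c', K (mon_sum (shift e (s' + s) (t' + t)) c') & c' l0 = c l0.
Proof.
move=> Kc.
have [c1 Kc1 E1] : exists2 c', K (mon_sum (shift e (s' + s) t) c') & c' l0 =
  c l0.
  elim: s' => [|s' [c' Kc' <-]]; first by exists c.
  have nz : rho ^+ (shift e (s' + s) t l0).2 != 0 by rewrite expf_neq0.
  exists (fun l => (rho ^+ (shift e (s' + s) t l0).2)^-1 *:
      (rho ^+ (shift e (s' + s) t l).2 *: c' l));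
        last by rewrite scalerA mulVf ?scale1r.
  rewrite -mon_sumZ; apply: (is_idealMl K_ideal).
  have := is_idealMr K_ideal Y Kc'; rewrite mon_sum_Y.
  by rewrite (@eq_mon_sum _ _ (shift e (s'.+1 + s) t) _ _ _ (frefl _)) // => l;
     rewrite /shift /= addn0 addn1 addSn addnS.
elim: t' => [|t' [c' Kc' <-]]; first by exists c1.
exists c' => //; have := is_idealMr K_ideal z Kc'; rewrite mon_sum_z.
by rewrite (@eq_mon_sum _ _ (shift e (s' + s) (t'.+1 + t)) _ _ _ (frefl _))
  // => l;
   rewrite /shift /= addn0 addn1 addSn addnS.
Qed.

(** The coefficients occurring at [l0], up to shift, form an {alpha, gamma}-ideal: left
    multiplication by [Y] acts on them as alpha, and by [z] as gamma up to a nonzero scalar. *)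
Lemma leading_coef1 (e : 'I_N -> nat * nat) c l0 :
    injective e -> K (mon_sum e c) -> c l0 <> 0 ->
  exists s t c', K (mon_sum (shift e s t) c') /\ c' l0 = 1.
Proof.
move=> e_inj Kc nz_c.
pose H a := exists s t c', K (mon_sum (shift e s t) c') /\ c' l0 = a.
suff : forall a, H a by exact.
have HI : is_ideal H.
  split.
  - exists 0%N, 0%N, (fun=> 0); split=> //.
    by rewrite mon_sum0; apply: is_ideal0 K_ideal.
  - move=> a b [s [t [c1 [Kc1 <-]]]] [s' [t' [c2 [Kc2 <-]]]].
    have [c1' Kc1' <-] := shift_up l0 s' t' Kc1.
    have [c2' Kc2' <-] := shift_up l0 s t Kc2.
    exists (s' + s)%N, (t' + t)%N, (fun l => c1' l - c2' l); split=> //.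
    by rewrite -mon_sumB; apply: is_idealB => //; rewrite addnC (addnC t').
  - move=> r a [s [t [c1 [Kc1 <-]]]]; exists s, t, (fun l => r * c1 l).
    by split=> //; rewrite -mon_sumM; apply: is_idealMl.
  - move=> r a [s [t [c1 [Kc1 <-]]]].
    pose f := shift e s t.
    (* Chosen so that moving [b] to the left of the monomial at [l0] turns it into [r]. *)
    pose b := iter (f l0).2 (aut_inv gamma) (iter (f l0).1 (aut_inv alpha) r).
    exists s, t, (fun l => c1 l * iter (f l).1 alpha (iter (f l).2 gamma b)).
    by rewrite -mon_sum_mulr !iter_autVK; split=> //; apply: is_idealMr.
have [||H0 | //] := A_simple HI.
- move=> a [s [t [c1 [Kc1 <-]]]]; exists s.+1, t, (fun l => alpha (c1 l));
  split=> //.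
  have := is_idealMl K_ideal Y Kc1; rewrite Y_mon_sum.
  by rewrite (@eq_mon_sum _ _ (shift e s.+1 t) _ _ _ (frefl _)) // => l;
     rewrite /shift /= addn0 addn1 addnS.
- move=> a [s [t [c1 [Kc1 <-]]]].
  have nz : rho ^+ (shift e s t l0).1 != 0 by rewrite expf_neq0.
  exists s, t.+1, (fun l => (rho ^+ (shift e s t l0).1)^-1 *:
      (rho ^+ (shift e s t l).1 *: gamma (c1 l))); split;
        last by rewrite scalerA mulVf ?scale1r.
  rewrite -mon_sumZ; apply: (is_idealMl K_ideal).
  have := is_idealMl K_ideal z Kc1; rewrite z_mon_sum.
  by rewrite (@eq_mon_sum _ _ (shift e s t.+1) _ _ _ (frefl _)) // => l;
     rewrite /shift /= addn0 addn1 addnS.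
case: nz_c; apply/H0; exists 0%N, 0%N, c; split=> //.
move: Kc; rewrite (@eq_mon_sum _ _ (shift e 0 0) _ _ _ (frefl _)) // => l.
by rewrite /shift !addn0 -surjective_pairing.
Qed.

Section Relations.

(** Encodes minimality of [N]: dropping an empty slot would leave a shorter nonzero element of
    [K]. *)
Hypothesis K_min : forall (e : 'I_N -> nat * nat) c,
  K (mon_sum e c) -> injective e -> forall l0, c l0 = 0 -> forall l, c l = 0.

Variables (e : 'I_N -> nat * nat) (c : 'I_N -> A) (l0 : 'I_N).
Hypotheses (e_inj : injective e) (Kc : K (mon_sum e c)) (c1 : c l0 = 1).
Hypothesis l0_min : forall l, ((e l0).1 <= (e l).1)%N.

Let i l := (e l).1.
Let k l := (e l).2.

(** The twist on the left is the one of the monomial at [l0], whose coefficient is 1, so the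
    commutator has an empty slot there and vanishes. The next two lemmas do the same with [z] and
    [Y]. *)
Lemma min_comm a l :
  iter (i l0) alpha (iter (k l0) gamma a) * c l
  = c l * iter (i l) alpha (iter (k l) gamma a).
Proof.
pose a' := iter (i l0) alpha (iter (k l0) gamma a).
have := is_idealB K_ideal (is_idealMl K_ideal (jA a') Kc)
  (is_idealMr K_ideal (jA a) Kc).
rewrite mon_sumM mon_sum_mulr mon_sumB => /K_min/(_ e_inj l0) E.
by apply/eqP; rewrite -subr_eq0; apply/eqP/E; rewrite // c1 mulr1 mul1r subrr.
Qed.

Lemma min_gamma l : rho ^+ i l *: gamma (c l) = rho ^+ i l0 *: c l.
Proof.
have := is_idealB K_ideal (is_idealMl K_ideal z Kc)
  (is_idealMr K_ideal z (is_idealMl K_ideal (sc (rho ^+ i l0)) Kc)).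
rewrite z_mon_sum mon_sumZ mon_sum_z mon_sumB.
move=> /K_min/(_ (shift_inj e_inj) l0) E.
by apply/eqP; rewrite -subr_eq0; apply/eqP/E; rewrite // c1 rmorph1 subrr.
Qed.

Lemma min_alpha l : rho ^+ k l0 *: alpha (c l) = rho ^+ k l *: c l.
Proof.
have := is_idealB K_ideal (is_idealMl K_ideal (sc (rho ^+ k l0)) (is_idealMl
  K_ideal Y Kc))
  (is_idealMr K_ideal Y Kc).
rewrite Y_mon_sum mon_sumZ mon_sum_Y mon_sumB.
move=> /K_min/(_ (shift_inj e_inj) l0) E.
by apply/eqP; rewrite -subr_eq0; apply/eqP/E; rewrite // c1 rmorph1 subrr.
Qed.

Lemma min_betaA l :
  rho ^+ (i l + k l) *: betaA (c l) = rho ^+ (i l0 + k l0) *: c l.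
Proof.
apply: alpha_inj; rewrite !autZ alpha_betaA exprD mulrC -scalerA.
by rewrite min_gamma exprD -[in RHS]scalerA min_alpha !scalerA mulrC.
Qed.

Lemma min_v_sum l : c l * v_sum alpha v rho (i l - i l0) = 0.
Proof.
(* Writing [f = f' y^i0], the element [f (lam z + b)] is a multiple of
   [f' x y y^i0], so that [Kg] concerns a commutator of [x] with [f'] times a
   power of [y], although [f'] itself need not lie in [K]. *)
pose b := iter (i l0) (aut_inv alpha) u.
have gamma_b n : iter n gamma b = b.
  elim: n => //= n ->; rewrite /b; elim: (i l0) => /= [|m IH];
    first exact: gamma_u.
  by rewrite aut_invV_comm IH.
pose lam := rho ^+ (i l0 + k l0).
have Kg := is_idealB K_ideal (is_idealMr K_ideal Y (is_idealMl K_ideal x Kc))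
  (is_idealD K_ideal (is_idealMr K_ideal z (is_idealMl K_ideal (sc lam) Kc))
     (is_idealMr K_ideal (jA (rho ^+ k l0 *: b)) Kc)).
move: Kg; rewrite x_mon_sum_Y mon_sumZ mon_sum_z mon_sum_mulr.
(* The shifted parts cancel by [min_betaA]; what remains has the exponents [e] and an empty slot
   [l0]. *)
rewrite (@eq_mon_sum _ _ (shift e 0 1) _ (fun l => lam *: c l) (frefl _));
  last exact: min_betaA.
rewrite [X in K (X - _)]addrC addrKA mon_sumB => /K_min/(_ e_inj l0) E.
have {E} : rho ^+ k l *: (betaA (c l) * u)
    - c l * iter (i l) alpha (iter (k l) gamma (rho ^+ k l0 *: b)) = 0.
  apply: E => //; rewrite c1 /betaA rmorph1 -{1}(rmorph1 alpha) autK !mul1r.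
  by rewrite !iter_autZ gamma_b iter_autVK subrr.
rewrite !iter_autZ gamma_b.
have -> : iter (i l) alpha b = iter (i l - i l0) alpha u.
  have /subnK {1}<- : (i l0 <= i l)%N := l0_min l.
  by rewrite iterD iter_autVK.
move/eqP; rewrite subr_eq0 => /eqP E.
have nz : rho ^+ (i l0 + k l0) != 0 by rewrite expf_neq0.
apply: (scalerI nz); rewrite scaler0 v_sumE mulrBr scalerBr scalerAl -min_betaA.
rewrite -scalerAl exprD -scalerA E -!scalerAr !scalerA -!exprD.
have /subnKC E' : (i l0 <= i l)%N := l0_min l.
by rewrite addnAC E' subrr.
Qed.

Lemma min_mul_comm a l : exists a', a * c l = c l * a'.
Proof.
exists (iter (i l) alpha (iter (k l) gamma
  (iter (k l0) (aut_inv gamma) (iter (i l0) (aut_inv alpha) a)))).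
by rewrite -min_comm !iter_autVK.
Qed.

Lemma min_comm_mul b l : exists b', c l * b = b' * c l.
Proof.
exists (iter (i l0) alpha (iter (k l0) gamma
  (iter (k l) (aut_inv gamma) (iter (i l) (aut_inv alpha) b)))).
by rewrite min_comm !iter_autVK.
Qed.

(** Otherwise [min_v_sum] and (iii) give c_l u^n = 0. As c_l b = 1 for some b, and c_l b = b' c_l,
    this yields u^n = b' c_l u^n = 0. *)
Lemma min_i_eq l : c l <> 0 -> i l = i l0.
Proof.
move=> nz_c; apply/eqP; rewrite eqn_leq l0_min andbT leqNgt;
  apply/negP => lt_il.
have [n [a Ea]] : exists n a, u ^+ n = v_sum alpha v rho (i l - i l0) * a.
  by apply: v_sum_divides; rewrite subn_gt0.
have cu : c l * u ^+ n = 0 by rewrite Ea mulrA min_v_sum mul0r.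
have [|||b Eb] := @normal_unit (c l) A_simple nz_c.
- by move=> a0; apply: min_mul_comm.
- exists ((rho ^+ k l0)^-1 * rho ^+ k l); rewrite -scalerA -min_alpha scalerA.
  by rewrite mulVf ?expf_neq0 // scale1r.
- exists ((rho ^+ i l)^-1 * rho ^+ i l0); rewrite -scalerA -min_gamma scalerA.
  by rewrite mulVf ?expf_neq0 // scale1r.
case: u_not_nilpotent; exists n; have [b' Eb'] := min_comm_mul b l.
by rewrite -[_ ^+ n]mul1r -Eb Eb' -mulrA cu mulr0.
Qed.

Lemma min_support l : l != l0 -> c l = 0.
Proof.
move=> nl; apply: NNPP => nz_c; have Ei := min_i_eq nz_c.
have nk : k l != k l0.
  apply: contraNneq nl => Ek; rewrite -(inj_eq e_inj).
  apply/eqP; rewrite [LHS]surjective_pairing [RHS]surjective_pairing.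
  by congr (_, _).
have gamma_c : gamma (c l) = c l.
  apply: (scalerI (expf_neq0 (i l) rho_neq0)).
  by rewrite min_gamma Ei.
have iter_c n : iter n gamma (c l) = c l by elim: n => //= n ->.
case: no_special; exists ((k l)%:Z - (k l0)%:Z); split.
  by apply/eqP; rewrite subr_eq0 eqz_nat.
exists (c l); split=> //.
- by rewrite expr0z scale1r.
- apply: (scalerI (expf_neq0 (k l0) rho_neq0)).
  have -> : rho ^ ((k l)%:Z - (k l0)%:Z) = rho ^+ k l / rho ^+ k l0.
    by rewrite expfzDr // exprnN.
  by rewrite min_alpha scalerA mulrC divfK // expf_neq0.
- rewrite opprB; split=> [a /=|/=].
    (* Writing [a] through [b] makes [min_comm] applicable; since [i l = i l0], the powers of alpha
       agree and only a power of gamma is left. *)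
    pose b := iter (k l) (aut_inv gamma) (iter (i l) (aut_inv alpha) a).
    have Ea : a = iter (i l) alpha (iter (k l) gamma b) by rewrite !iter_autVK.
    rewrite {1}Ea -min_comm -Ei; congr (_ * _).
    by rewrite [in RHS]Ea !iter_alpha_iter_gamma aut_exp_subz.
  by rewrite -{1}(iter_c (k l)) aut_exp_subz iter_c.
Qed.

Lemma min_mon : K (mon (i l0) (k l0)).
Proof.
suff <- : mon_sum e c = mon (i l0) (k l0) by [].
rewrite /mon_sum (bigD1 l0) //= c1 jA1 mul1r big1 ?addr0 // => l nl.
by rewrite min_support // jA0 mul0r.
Qed.

End Relations.
End Minimal.

(** * From a nonzero element of [K] to a power of [z] *)

Lemma contains_mon N (e : 'I_N -> nat * nat) c l1 :
    injective e -> K (mon_sum e c) -> c l1 <> 0 ->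
  exists i k, K (mon i k).
Proof.
elim: N e c l1 => [|N IH] e c l1 e_inj Kc nz_c; first by case: l1 {nz_c}.
apply: NNPP => noK.
(* If a slot is empty but another is not, removing the empty one lets the induction hypothesis
   produce a monomial in [K]. *)
have K_min (f : 'I_N.+1 -> nat * nat) d : K (mon_sum f d) -> injective f ->
    forall l0, d l0 = 0 -> forall l, d l = 0.
  move=> Kd f_inj l0 d0 l; case: (unliftP l0 l) => [l' ->|-> //].
  apply: NNPP => nz_d; apply: noK.
  apply: (IH (f \o lift l0) (d \o lift l0) l') => //.
    by apply: inj_comp f_inj _; apply: lift_inj.
  by move: Kd; rewrite /mon_sum (bigD1_ord l0) //= d0 jA0 mul0r add0r.
(* By [K_min] no coefficient of this sum vanishes, so [l0] can be chosen by its exponent alone. *)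
pose l0 := [arg min_(l < l1) (e l).1]%N.
have l0_min l : ((e l0).1 <= (e l).1)%N.
  by rewrite /l0; case: arg_minnP => // l' _; apply.
have nz_c0 : c l0 <> 0 by move=> c0; apply: nz_c;
  apply: (K_min _ _ Kc e_inj _ c0).
have [s [t [d [Kd d1]]]] := leading_coef1 e_inj Kc nz_c0.
apply: noK; exists (shift e s t l0).1, (shift e s t l0).2.
apply: (min_mon K_min (shift_inj e_inj) Kd d1) => l.
by rewrite leq_add2r.
Qed.

(** With g = Y^i z^k, multiplying Y^(i+1) z^k by [x] on the left gives (z + u) g, and on the right,
    up to a scalar, (z + rho^(i+1) alpha^(i+1)(u)) g. The difference is v^(i+1) g, so (iii) puts u^n
    g in [K]. *)
Lemma contains_power i k : K (mon i k) -> exists n, K (z ^+ n).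
Proof.
elim: i k => [|i IH] k Ki; first by exists k; rewrite /mon mul1r in Ki.
pose g := mon i k; pose w := v_sum alpha v rho i.+1.
have Kzu : K ((z + jA u) * g).
  by have := is_idealMl K_ideal x Ki; rewrite -Y_mon mulrA xY.
have Kw : K (jA w * g).
  have E1 : sc (rho ^+ k) * (mon i.+1 k * x) = Y ^+ i * (Y * x) * z ^+ k.
    rewrite /mon -(mulrA _ _ x) (q_commX' _ z_x) -(mulrA (sc _)) sc_swap.
    rewrite mulrA scM -exprMn mulfV // expr1n sc1 mul1r exprSr !mulrA //.
  have E2 : sc (rho ^+ i.+1) * (Y ^+ i * (Y * x) * z ^+ k)
      = (z + jA (rho ^+ i.+1 *: iter i.+1 alpha u)) * g.
    rewrite Yx mulrDr sc_swap Yn_jA -iterSr !mulrDl mulrDr /g /mon;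
      congr (_ + _).
      rewrite !mulrA scM exprSr mulfK //; congr (_ * _).
      by rewrite (q_commX _ z_Y).
    by rewrite jAZ !mulrA.
  have := is_idealMl K_ideal (sc (rho ^+ i.+1))
    (is_idealMl K_ideal (sc (rho ^+ k)) (is_idealMr K_ideal x Ki)).
  rewrite E1 E2 => /(is_idealB K_ideal Kzu).
  by rewrite -mulrBl [z + _]addrC addrKA -jAB -v_sumE.
have [n [a Ea]] := v_sum_divides (ltn0Sn i).
have Ku : K (jA (u ^+ n) * g).
  pose a' := iter k (aut_inv gamma) (iter i (aut_inv alpha) a).
  have := is_idealMr K_ideal (jA a') Kw.
  by rewrite -mulrA mon_jA !iter_autVK mulrA -jAM -Ea.
(* Modulo (z + u) g, each factor u can be traded for [z] up to sign. *)
have Kz j : K (jA (u ^+ n) * z ^+ j * g) -> K (z ^+ (n + j) * g).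
  elim: n {Ku Ea} j => [|n IHn] j; first by rewrite jA1 mul1r.
  move=> Ku; rewrite addSnnS; apply: IHn.
  have E : jA (u ^+ n) * z ^+ j * (jA u * g) = jA (u ^+ n.+1) * z ^+ j * g.
    by rewrite mulrA -(mulrA _ _ (jA u)) zn_jA (iter_fix _ gamma_u) mulrA
      -jAM -exprSr.
  have := is_idealB K_ideal (is_idealMl K_ideal (jA (u ^+ n) * z ^+ j) Kzu) Ku.
  by rewrite -E mulrDl mulrDr addrK mulrA -(mulrA _ _ z) -exprSr.
have Kmon m l : K (z ^+ m * mon i l) -> K (mon i (m + l)).
  elim: m l => [|m IHm] l; first by rewrite mul1r.
  rewrite exprSr -mulrA z_mon sc_swap addSnnS => Kl; apply: IHm.
  by apply: K_scal Kl; rewrite expf_neq0.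
by apply: (IH (n + k)%N); apply: Kmon; have := Kz 0%N; rewrite mulr1 addn0;
  apply.
Qed.

Lemma nonzero_contains_power r : K r -> r != 0 -> exists n, K (z ^+ n).
Proof.
move=> Kr nz_r; have [m [q Eq]] := mul_Yn_pos r.
have [N [e [c [e_inj Ec]]]] := ore_eval_mon_sum q.
have Kc : K (mon_sum e c) by rewrite -Ec -Eq; apply: is_idealMr.
have [l nz_c] : exists l, c l <> 0.
  apply: NNPP => c0; case/eqP: nz_r; apply: (@Y_regular _ m); rewrite Eq Ec.
  rewrite -[RHS](mon_sum0 e); apply: eq_mon_sum => // l.
  by apply: NNPP => nz_c; apply: c0; exists l.
by have [i [k]] := contains_mon e_inj Kc nz_c; apply: contains_power.
Qed.

End IdealContainsPower.

Lemma jA_inj : injective jA.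
Proof. exact: inj_comp (ore_iota_inj R_ore) (ore_iota_inj T_ore). Qed.

(** * Necessity *)

Section PowersInIdeals.

Hypothesis ideal_power : forall (K : R -> Prop) (r : R),
  is_ideal K -> K r -> r != 0 -> exists n, K (z ^+ n).

(** * Necessity of (i) *)

Lemma base_simple : simple_under2 alpha gamma.
Proof.
move=> I II I_alpha I_gamma.
case: (classic (exists2 a, I a & a <> 0)) => [[a0 Ia0 nz_a0]|I0]; last first.
  left=> a; split=> [Ia|->]; last exact: is_ideal0 II.
  by apply: NNPP => nz_a; apply: I0; exists a.
right; pose tau n a := iter n alpha (iter n gamma a).
have tauS n a : tau n.+1 a = alpha (gamma (tau n a)).
  by rewrite /tau /= iter_alpha_gamma.
have tau_alpha n a : tau n (alpha a) = alpha (tau n a).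
  by elim: n => // n IH; rewrite !tauS IH -alpha_gamma.
have tau_gamma n a : tau n (gamma a) = gamma (tau n a).
  by elim: n => // n IH; rewrite !tauS IH alpha_gamma.
have I_tau n m a : I (tau n a) -> I (tau (m + n)%N a).
  by move=> Ia; elim: m => // m IH; rewrite addSn tauS; apply/I_alpha/I_gamma.
pose I' a := exists n, I (tau n a).
have I'0 : I' 0 by exists 0%N; apply: is_ideal0 II.
have I'D a b : I' a -> I' b -> I' (a + b).
  move=> [n Ia] [m Ib]; exists (m + n)%N; rewrite /tau !iter_autD.
  by apply: (is_idealD II); [apply: I_tau | rewrite addnC; apply: I_tau].
have I'Ml r a : I' a -> I' (r * a).
  by move=> [n Ia]; exists n; rewrite /tau !iter_autM; apply: (is_idealMl II).
have I'Mr r a : I' a -> I' (a * r).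
  by move=> [n Ia]; exists n; rewrite /tau !iter_autM; apply: (is_idealMr II).
have I'alpha a : I' a -> I' (alpha a).
  by move=> [n Ia]; exists n; rewrite tau_alpha; apply: I_alpha.
(* Needed because [x] moves past [A] through beta. Here tau_(n+1)(beta(a)) = gamma^2(tau_n(a)). *)
have I'beta a : I' a -> I' (betaA a).
  move=> [n Ia]; exists n.+1.
  rewrite tauS alpha_gamma -tau_alpha alpha_betaA tau_gamma.
  by apply/I_gamma/I_gamma.
pose G r := exists a w, I' a /\ r = jA a * w.
have G_left r a w : I' a -> add_span G (r * (jA a * w)).
  elim/ambiskew_gen: r a w => [b|||r s Hr Hs|r s Hr Hs] a w Ia.
  - by apply: add_span_gen; exists (b * a), w; rewrite jAM mulrA; split=> //;
    apply: I'Ml.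
  - by apply: add_span_gen; exists (alpha a), (Y * w);
    rewrite mulrA Y_jA mulrA; split=> //; apply: I'alpha.
  - by apply: add_span_gen; exists (betaA a), (x * w);
    rewrite mulrA x_jA mulrA; split=> //; apply: I'beta.
  - by rewrite mulrDl; apply: add_span_add; [apply: Hr | apply: Hs].
  rewrite -mulrA; elim: (Hs a w Ia) => [|x1 x2 [a1 [w1 [Ia1 ->]]] _ IH].
    by rewrite mulr0; apply: add_span0.
  by rewrite mulrDr; apply: add_span_add => //; apply: Hr.
have KI : is_ideal (add_span G).
  apply: add_span_ideal => r _ [a [w [Ia ->]]]; first exact: G_left.
  by apply: add_span_gen; exists a, (w * r); rewrite mulrA.
have [||n Kn] := ideal_power KI (r := jA a0).
- apply: add_span_gen; exists a0, 1; rewrite mulr1; split=> //; exists 0%N;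
  exact: Ia0.
- by apply/eqP=> E; apply: nz_a0; apply: jA_inj; rewrite E jA0.
(* [P] says that all coefficients in [A] lie in [I']. The leading one of z^n is a nonzero scalar,
   which forces 1 into [I']. *)
pose P r := exists q, r = ore_eval iT x q /\ forall j, exists p,
  q`_j = ore_eval iA y p /\ forall i, I' p`_i.
have [q [Eq Hq]] : P (z ^+ n).
  apply: add_span_sub Kn => [|r1 r2|_ [a [w [Ia ->]]]].
  - exists 0; rewrite ore_eval0; split=> // j; exists 0;
    rewrite coef0 ore_eval0.
    by split=> // i; rewrite coef0.
  - move=> [q1 [-> H1]] [q2 [-> H2]]; exists (q1 + q2); rewrite ore_evalD;
    split=> // j.
    have [p1 [E1 I1]] := H1 j; have [p2 [E2 I2]] := H2 j.
    exists (p1 + p2); rewrite coefD ore_evalD E1 E2; split=> // i.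
    by rewrite coefD; apply: I'D.
  - have [q ->] := ore_eval_surj R_ore w; exists ((iA a)%:P * q).
    rewrite ore_eval_lmul; split=> // j; rewrite coefCM.
    have [p ->] := ore_eval_surj T_ore q`_j; exists (a%:P * p).
    by rewrite ore_eval_lmul; split=> // i; rewrite coefCM; apply: I'Mr.
have [k [k0 topz]] := zn_top n; rewrite Eq in topz.
have [p [Ep Ip]] := Hq n; move: Ep; rewrite -(ore_top_coef R_ore topz).
rewrite /ymon -(ore_evalC iA y) -ore_evalMXn => /(ore_eval_inj T_ore) Ep.
have [m] : I' 1.
  have := I'Ml (k^-1)%:A _ (Ip n).
  by rewrite -Ep coefMXn ltnn subnn coefC -scalerAl mul1r scalerA mulVf //
    scale1r.
rewrite /tau !iter_aut1 => I1 a.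
by rewrite -[a]mulr1; apply: is_idealMl.
Qed.

(** * Necessity of (ii) *)

Lemma special_unit_absurd c b n :
    (0 < n)%N -> c * b = 1 -> (forall a, c * a = iter n gamma a * c) ->
    rho ^+ n *: alpha c = c -> gamma c = c ->
  False.
Proof.
move=> n_gt0 cb c_comm alpha_c gamma_c.
have beta_c : betaA c = rho ^+ n *: c.
  by apply: alpha_inj; rewrite alpha_betaA autZ alpha_c gamma_c.
(* The conditions on c give both summands the same commutation rule with each generator, so [p] is
   normal. *)
pose p := z ^+ n + jA c.
have p_left r : exists r', r * p = p * r'.
  elim/ambiskew_gen: r => [a|||r s [r' Er] [s' Es]|r s [r' Er] [s' Es]].
  - exists (jA (iter n (aut_inv gamma) a)).
    by rewrite mulrDl zn_jA -[jA c * _]jAM c_comm jAM -mulrDr iter_autVK.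
  - exists (sc (rho ^+ n)^-1 * Y); rewrite sc_swap.
    have -> : p * Y = sc (rho ^+ n) * (Y * p).
      rewrite /p mulrDl !mulrDr (q_commX' _ z_Y) mulrA Y_jA.
      by rewrite [sc _ * (jA _ * Y)]mulrA -jAZ alpha_c.
    by rewrite sc_unitl ?expf_neq0.
  - exists (sc (rho ^+ n) * x); rewrite sc_swap.
    by rewrite /p mulrDr mulrDl mulrDr (q_commX _ x_z) x_jA beta_c jAZ !mulrA.
  - by exists (r' + s'); rewrite mulrDl [RHS]mulrDr Er Es.
  - by exists (r' * s'); rewrite -mulrA Es (mulrA r) Er -mulrA.
pose K r := exists w, r = p * w.
have KI : is_ideal K.
  split.
  - by exists 0; rewrite mulr0.
  - by move=> _ _ [a ->] [d ->]; exists (a - d); rewrite mulrBr.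
  - move=> r _ [w ->]; have [r' Er] := p_left r.
    by exists (r' * w); rewrite (mulrA r) Er -mulrA.
  - by move=> r _ [w ->]; exists (w * r); rewrite mulrA.
have [k [k0 topz]] := zn_top n.
have topp : ore_top iT x n (ymon k n) p.
  apply: ore_topD topz _; rewrite /jA -[iT _]mulr1 -(expr0 x).
  exact: ore_deg_lt_mon.
have [||m Km] := ideal_power KI (r := p).
- by exists 1; rewrite mulr1.
- apply/eqP=> p0; move: topp; rewrite p0 => /(ore_top0 R_ore).
  by rewrite -[ymon k n]mulr1 => /(ymon_mulr_eq0 k0)/eqP; rewrite oner_eq0.
(* Since z^m c = z^m p - z^m z^n and c is right invertible, membership of z^(m+1) in [K] descends to
   z^m. *)
have [w Ew] : K 1.
  elim: m Km => [//|m IH] Km; apply: IH.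
  have Kp : K (z ^+ m * p) by apply: (is_idealMl KI); exists 1; rewrite mulr1.
  have Kzn : K (z ^+ m * z ^+ n).
    by rewrite -(prednK n_gt0) exprS mulrA -exprSr; apply: (is_idealMr KI).
  have := is_idealMr KI (jA b) (is_idealB KI Kp Kzn).
  by rewrite mulrDr addrAC subrr add0r -mulrA -jAM cb jA1 mulr1.
have nz_w : w != 0 by apply/eqP=> w0; move/eqP: Ew; rewrite w0 mulr0 oner_eq0.
(* The product of the leading terms of [p] and [w] has positive degree in [x], so it cannot occur in
   1. *)
have [m' [t [nz_t top_w]]] := ore_top_ex R_ore nz_w.
have := ore_topM R_ore topp top_w; rewrite -Ew -(rmorph1 iT) -(ore_evalC iT x).
move/(ore_top_coef R_ore);
  rewrite coefC addn_eq0 (gtn_eqF n_gt0) /= => /(ymon_mulr_eq0 k0).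
move=> bt; case/eqP: nz_t; move: bt.
have beta_inj : injective beta by apply: bij_inj (ambiskew_beta_bij R_ambiskew).
elim: (n) => //= l IH E; apply: IH; apply: beta_inj.
by rewrite E rmorph0.
Qed.

Lemma special_absurd j c : j <> 0 -> special alpha gamma rho 0 j c -> False.
Proof.
move=> nz_j [nz_c gamma_c alpha_c [c_comm _]].
have A_simple := base_simple.
rewrite expr0z scale1r in gamma_c.
have c_comm' a : exists a', a * c = c * a'.
  case: j c_comm {nz_j alpha_c} => n c_comm.
    by exists (iter n gamma a); rewrite c_comm /= -[- _]sub0r aut_exp_subz.
  by exists (iter n.+1 (aut_inv gamma) a); rewrite c_comm; congr (_ * c);
    rewrite /= -!iterS iter_autVK.
have [||b cb] := normal_unit A_simple nz_c c_comm'.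
- by exists (rho ^ j).
- by exists 1; rewrite scale1r.
(* [Negz n] is -(n+1) and is covered directly; for positive j, c is replaced by its inverse. *)
case: j nz_j alpha_c c_comm => n nz_j alpha_c c_comm; last first.
  apply: (@special_unit_absurd c b n.+1) => //.
  by rewrite alpha_c scalerA mulfV ?scale1r // expf_neq0.
have n_gt0 : (0 < n)%N by case: (n) nz_j.
have {}c_comm a : a * c = c * iter n gamma a.
  by rewrite c_comm /= -[- _]sub0r aut_exp_subz.
have bc : b * c = 1.
  have [d dc] : exists d, d * c = 1.
    by exists (iter n (aut_inv gamma) b); rewrite c_comm iter_autVK.
  suff -> : b = d by [].
  by rewrite -[b]mul1r -dc -mulrA cb mulr1.
have can_c a a' : c * a = c * a' -> a = a'.
  by move/(congr1 (fun w => b * w)); rewrite !mulrA bc !mul1r.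
apply: (@special_unit_absurd b c n) => // [a||].
- by apply: can_c; rewrite !mulrA cb mul1r -c_comm -mulrA cb mulr1.
- apply: can_c; rewrite cb -scalerAr scalerAl -alpha_c.
  by rewrite -autM cb rmorph1.
- by apply: can_c; rewrite cb -{1}gamma_c -autM cb rmorph1.
Qed.

(** * Necessity of (iii) *)

Section Truncation.

Variable m : nat.
Hypothesis m_gt0 : (0 < m)%N.
Let w := v_sum alpha v rho m.

Let in_w (a : A) := exists b, a = w * b.

Lemma in_wD a b : in_w a -> in_w b -> in_w (a + b).
Proof. by move=> [c ->] [d ->]; exists (c + d); rewrite mulrDr. Qed.

Lemma in_wMl r a : in_w a -> in_w (r * a).
Proof.
move=> [c ->]; exists (aut_inv gamma r * c).
by rewrite mulrA [RHS]mulrA; congr (_ * _); rewrite /w v_sum_comm autVK.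
Qed.

Lemma in_wMr r a : in_w a -> in_w (a * r).
Proof. by move=> [c ->]; exists (c * r); rewrite mulrA. Qed.

Lemma in_w_gamma a : in_w a -> in_w (gamma a).
Proof. by move=> [c ->]; exists (gamma c); rewrite autM gamma_v_sum. Qed.

(* [t] vanishes in the quotient module of [R / R x] used for (iii), where
   [R / R x] is identified with [T] and [x] acts on it through [delta]. *)
Definition trunc (t : T) : Prop := exists p : {poly A},
  t = ore_eval iA y p /\
  forall i, (i < m)%N -> in_w (iter (m.-1 - i) alpha p`_i).

Lemma trunc0 : trunc 0.
Proof.
exists 0; rewrite ore_eval0; split=> // i _; exists 0.
by rewrite coef0 mulr0 iter_aut0.
Qed.

Lemma truncD s t : trunc s -> trunc t -> trunc (s + t).
Proof.
move=> [p [-> Hp]] [q [-> Hq]]; exists (p + q); rewrite ore_evalD;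
  split=> // i lt_im.
by rewrite coefD iter_autD; apply: in_wD; [apply: Hp | apply: Hq].
Qed.

Lemma trunc_mon a j :
  ((j < m)%N -> in_w (iter (m.-1 - j) alpha a)) -> trunc (iA a * y ^+ j).
Proof.
move=> Ha; exists (a%:P * 'X^j); rewrite ore_evalMXn ore_evalC;
  split=> // i lt_im.
rewrite coefCM coefXn; case: eqP => [Ei|_]; last first.
  by exists 0; rewrite !mulr0 iter_aut0.
by rewrite mulr1 Ei; apply: Ha; rewrite -Ei.
Qed.

Lemma trunc_sum n (f : 'I_n -> T)
  : (forall i, trunc (f i)) -> trunc (\sum_i f i).
Proof. by move=> Hf; apply: (big_ind trunc) => //;
  [apply: trunc0 | apply: truncD]. Qed.

Lemma trunc_iA a t : trunc t -> trunc (iA a * t).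
Proof.
move=> [p [-> Hp]]; rewrite ore_evalE mulr_sumr; apply: trunc_sum => i.
rewrite mulrA -rmorphM; apply: trunc_mon => lt_im; rewrite iter_autM.
by apply: in_wMl; apply: Hp.
Qed.

Lemma trunc_y t : trunc t -> trunc (y * t).
Proof.
move=> [p [-> Hp]]; rewrite ore_evalE mulr_sumr; apply: trunc_sum => i.
rewrite mulrA y_iA -mulrA -exprS; apply: trunc_mon => lt_im.
have := Hp i (ltnW lt_im).
suff -> : (m.-1 - i)%N = (m.-1 - i.+1).+1 by rewrite iterSr.
by rewrite subnS prednK // subn_gt0 -ltnS prednK.
Qed.

Lemma trunc_yn t : trunc (y ^+ m * t).
Proof.
elim/(ore_ind T_ore): t => [r s Hr Hs|a n]; first by rewrite mulrDr;
  apply: truncD.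
have -> : y ^+ m * (iA a * y ^+ n) = iA (iter m alpha a) * y ^+ (m + n).
  rewrite mulrA exprD mulrA; congr (_ * _).
  by elim: (m) => [|l IH];
    rewrite ?mulr1 ?mul1r // !exprS -mulrA IH mulrA y_iA -mulrA.
by apply: trunc_mon; rewrite ltnNge leq_addr.
Qed.

(** Iterating [delta y = iA v] builds up v^(i). At [i = 0] the exponent [i.-1] is harmless since
    v^(0) = 0. *)
Lemma delta_mon a i :
  delta (iA a * y ^+ i) = iA (betaA a * v_sum alpha v rho i) * y ^+ i.-1.
Proof.
have [deltaD deltaM] := ambiskew_delta R_ambiskew.
rewrite deltaM (ambiskew_deltaA R_ambiskew) mul0r addr0.
rewrite (ambiskew_betaA R_ambiskew) rmorphM -mulrA; congr (_ * _).
elim: i => [|i IH].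
  by rewrite expr0 -(rmorph1 iA) (ambiskew_deltaA R_ambiskew) /v_sum big_geq
    // rmorph0 mul0r.
rewrite exprS deltaM IH (ambiskew_delta_y R_ambiskew) (ambiskew_beta_y
  R_ambiskew).
rewrite /v_sum big_nat_recl // expr0 scale1r rmorphD mulrDl addrC /=;
  congr (_ + _).
case: i {IH} => [|i]; first by rewrite !big_geq // rmorph0 !mul0r mulr0.
rewrite -mulrA (mulrA y) y_iA -mulrA -exprS mulrA -rmorphM; congr (iA _ * _).
rewrite -scalerAl mul1r (raddf_sum alpha) scaler_sumr; apply: eq_bigr => l _.
by rewrite /= autZ scalerA exprS.
Qed.

Lemma trunc_delta t : trunc t -> trunc (delta t).
Proof.
have [deltaD _] := ambiskew_delta R_ambiskew.
have delta0 : delta 0 = 0 by apply: (addrI (delta 0)); rewrite -deltaD !addr0.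
move=> [p [-> Hp]]; rewrite ore_evalE (big_morph delta deltaD delta0).
apply: trunc_sum => -[i _] /=; rewrite delta_mon.
case: i => [|i] /=.
  rewrite /v_sum big_geq // mulr0 rmorph0 mul0r; exact: trunc0.
apply: trunc_mon => lt_im.
have [lt_i1m|le_mi1] := ltnP i.+1 m; last first.
  (* Passing from the unrestricted degree [m] to [m.-1] produces the factor v^(m), which dictates
     the choice of [w]. *)
  have Ei : i.+1 = m by apply/eqP; rewrite eqn_leq lt_im.
  have -> : (m.-1 - i)%N = 0%N by rewrite -Ei subnn.
  by rewrite Ei; apply: in_wMl; exists 1; rewrite mulr1.
rewrite iter_autM; apply: in_wMr.
have -> : (m.-1 - i)%N = (m.-1 - i.+1).+1.
  by rewrite subnS prednK // subn_gt0 -ltnS prednK.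
by rewrite iterSr alpha_betaA iter_alpha_gamma; apply: in_w_gamma; apply: Hp.
Qed.

(** Says that [r] sends the class of 1 in the quotient module to zero. *)
Definition annihilates (r : R) : Prop :=
  exists t r', trunc t /\ r = iT t + r' * x.

Lemma annihilatesD r s : annihilates r -> annihilates s -> annihilates (r + s).
Proof.
move=> [t [r' [Ht ->]]] [t1 [r1 [Ht1 ->]]]; exists (t + t1), (r' + r1).
by rewrite rmorphD mulrDl addrACA; split=> //; apply: truncD.
Qed.

Lemma annihilatesM r s : annihilates s -> annihilates (r * s).
Proof.
elim/ambiskew_gen: r s => [a|||r1 r2 H1 H2|r1 r2 H1 H2] s.
- move=> [t [r' [Ht ->]]]; exists (iA a * t), (jA a * r').
  by rewrite mulrDr rmorphM mulrA; split=> //; apply: trunc_iA.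
- move=> [t [r' [Ht ->]]]; exists (y * t), (Y * r').
  by rewrite mulrDr rmorphM mulrA; split=> //; apply: trunc_y.
- move=> [t [r' [Ht ->]]]; exists (delta t), (iT (beta t) + x * r').
  rewrite mulrDr (ore_comm R_ore) [_ + iT (delta t)]addrC mulrDl -addrA mulrA.
  by split=> //; apply: trunc_delta.
- by move=> Hs; rewrite mulrDl; apply: annihilatesD; [apply: H1 | apply: H2].
- by move=> Hs; rewrite -mulrA; apply: H1; apply: H2.
Qed.

Lemma right_x_uniq t t' r r' : iT t + r * x = iT t' + r' * x -> t = t'.
Proof.
have [q ->] := ore_eval_surj R_ore r; have [q' ->] := ore_eval_surj R_ore r'.
rewrite -!(ore_evalC iT x) -!ore_evalMX -!ore_evalD => /(ore_eval_inj R_ore).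
by move/(congr1 (fun p : {poly T} => p`_0));
  rewrite !coefD !coefC !coefMX /= !addr0.
Qed.

Lemma v_sum_divides_power : exists n a, u ^+ n = w * a.
Proof.
pose G r := exists r1 r2, r = r1 * (Y ^+ m * r2).
have KI : is_ideal (add_span G).
  apply: add_span_ideal => r _ [r1 [r2 ->]]; apply: add_span_gen.
    by exists (r * r1), r2; rewrite mulrA.
  by exists r1, (r2 * r); rewrite !mulrA.
have [||n Kn] := ideal_power KI (r := Y ^+ m).
- by apply: add_span_gen; exists 1, 1; rewrite mul1r mulr1.
- by apply/eqP=> Y0; have := @Y_regular 1 m; rewrite mul1r => /(_ Y0)/eqP;
  rewrite oner_eq0.
have [t [r [[p [Et Hp]] Ez]]] : annihilates (z ^+ n).
  apply: add_span_sub Kn => [|r s|_ [r1 [r2 ->]]].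
  - by exists 0, 0; rewrite rmorph0 mul0r addr0; split=> //; apply: trunc0.
  - exact: annihilatesD.
  (* Terms of [r2] with a positive power of [x] kill the class of 1; the others send it into [T],
     where y^m acts as zero. *)
  apply: annihilatesM; elim/(ore_ind R_ore): r2 => [r s Hr Hs|t [|j]].
  - by rewrite mulrDr; apply: annihilatesD.
  - exists (y ^+ m * t), 0; split;
    last by rewrite mul0r addr0 mulr1 rmorphM rmorphXn.
    exact: trunc_yn.
  - exists 0, (Y ^+ m * iT t * x ^+ j); rewrite rmorph0 add0r exprSr !mulrA;
    split=> //.
    exact: trunc0.
(* Modulo R x the element [z] is [f], and z^n is f^n because gamma fixes [f]. *)
pose f := - (rho *: alpha u).
have gamma_f : gamma f = f by rewrite /f rmorphN /= autZ -alpha_gamma gamma_u.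
have [r' Ez'] : exists r', z ^+ n = iT (iA (f ^+ n)) + r' * x.
  elim: (n) => [|l [r' IH]]; first by exists 0; rewrite !rmorph1 mul0r addr0.
  exists (jA (f ^+ l) * sc rho * Y + z * r').
  rewrite exprS IH mulrDr z_jA rmorphXn /= gamma_f -/(jA _) mulrA [in
    RHS]mulrDl addrA.
  congr (_ + _); rewrite {1}z_eq mulrBr -jAZ !mulrA addrC; congr (_ + _).
  by rewrite exprSr jAM jAN mulrN.
have Ef : p = (f ^+ n)%:P.
  by apply: (ore_eval_inj T_ore); rewrite -Et ore_evalC;
    apply: right_x_uniq (etrans (esym Ez) Ez').
have {Hp} := Hp 0%N m_gt0; rewrite Ef coefC eqxx subn0 iter_autX /f => -[b Eb].
(* The degree 0 condition concerns alpha^(m-1)(f^n), a scalar multiple of (w - u)^n, which is (-u)^n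
   modulo wA. *)
have Ew : rho ^+ m.-1 *: iter m.-1 alpha (- (rho *: alpha u)) = - u + w.
  rewrite -scaleNr iter_autZ -iterSr prednK // scalerA mulrN -exprSr prednK //.
  by rewrite /w v_sumE addKr scaleNr.
have w_pow l : in_w ((- u + w) ^+ l - (- u) ^+ l).
  elim: l => [|l IH]; first by exists 0; rewrite subrr mulr0.
  rewrite !exprS mulrDl addrAC -mulrBr; apply: in_wD; first exact: in_wMl.
  by exists ((- u + w) ^+ l).
have [a Ea] : in_w ((-1) ^+ n * (- u) ^+ n).
  apply: in_wMl; rewrite -[_ ^+ n](subKr ((- u + w) ^+ n))
    -[X in in_w (_ + X)]mulN1r.
  apply: in_wD; last by apply: in_wMl; apply: w_pow.
  by rewrite -Ew exprZn Eb; exists (rho ^+ m.-1 ^+ n *: b); rewrite scalerAr.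
by exists n, a; rewrite -Ea -exprMn_comm ?mulrNN ?mul1r //;
  apply/commr_sym/commrN1.
Qed.

End Truncation.
End PowersInIdeals.

Lemma simple_localization_iff (S : nzRingType) (phi : {rmorphism R -> S}) :
    localization (powers z) phi -> ~ (exists n : nat, u ^+ n = 0) ->
  simple_ring S <->
  [/\ simple_under2 alpha gamma,
      ~ exists j : int, j <> 0 /\ exists c : A, special alpha gamma rho 0 j c
    & forall m : nat, (1 <= m)%N ->
        exists (n : nat) (a : A), u ^+ n = v_sum alpha v rho m * a].
Proof.
move=> S_loc u_not_nilpotent.
split=> [S_simple | [A_simple no_special v_sum_divides]].
  have ideal_power (K : R -> Prop) r :
      is_ideal K -> K r -> r != 0 -> exists n, K (z ^+ n).
    exact: (simple_loc_contains S_loc z_regular z_normal z_normal' S_simple).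
  split; first exact: base_simple.
    by move=> [j [nz_j [c c_special]]]; apply: special_absurd nz_j c_special.
  by move=> m; apply: v_sum_divides_power.
apply: (loc_simple S_loc) => K r KI Kr nz_r.
exact: (nonzero_contains_power KI A_simple u_not_nilpotent no_special
  v_sum_divides Kr).
Qed.

End Ambiskew.

Theorem theorem4p9
  (F : fieldType) (A : algType F)
  (rho : F) (rho_neq0 : rho <> 0)
  (alpha gamma : algAut A)
  (alpha_gamma : forall a, alpha (gamma a) = gamma (alpha a))
  (v : A) (v_normal : is_normal gamma v)
  (T : nzRingType) (iA : {rmorphism A -> T}) (y : T)
  (beta : {rmorphism T -> T}) (delta : T -> T)
  (R : nzRingType) (iT : {rmorphism T -> R}) (x : R)
  (R_ambiskew : ambiskew_ring alpha gamma v rho iA y beta delta iT x)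
  (u : A) (u_splitting : splitting_element alpha gamma v rho u)
  (S : nzRingType) (phi : {rmorphism R -> S})
  (S_loc : localization (powers (x * iT y - iT (iA u))) phi)
  (u_not_nilpotent : ~ exists n : nat, u ^+ n = 0) :
  simple_ring S <->
  [/\ simple_under2 alpha gamma,
      ~ exists j : int, j <> 0 /\ exists c : A, special alpha gamma rho 0 j c
    & forall m : nat, (1 <= m)%N ->
        exists (n : nat) (a : A), u ^+ n = v_sum alpha v rho m * a].
Proof.
exact: (simple_localization_iff (introN eqP rho_neq0) alpha_gamma R_ambiskew
  u_splitting erefl S_loc u_not_nilpotent).
Qed.
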